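(* Let $a>0$, $c>0$, $L_1,L_2,T>0$. There exist positive constants $C$ and $\bar\nu$ such that the following holds for every $\nu$ with $0<\nu\le\bar\nu$ and for all data $h\in\mathcal C_0^\infty(\Omega_1)$, $f\in\mathcal C_0^\infty(\Omega\times(0,T])$, $g_1\in\mathcal C_0^\infty((0,T])$, $g_2\equiv 0$, and every initial guess $g_{ad}^0\in\mathcal C_0^\infty((0,T])$. Let $u$ be the solution of the viscous problem on $\Omega=(-L_1,L_2)$ $$\mathcal L_{ad}u=f\ \text{in }\Omega\times(0,T),\quad u(-L_1,\cdot)=g_1,\quad \mathcal L_a u(L_2,\cdot)=g_2\ \text{on }(0,T),\quad u(\cdot,0)=h\ \text{in }\Omega,$$ and let $(u_{ad}^k,u_a^k)$, $k=1,2$, be the iterates of the factorization algorithm described in the context, started from $u_{ad}^0(0,\cdot)=g_{ad}^0$. Put $B_k:=\|f\|_{H^k(\Omega\times(0,T))}^2+\|h\|_{H^k(\Omega)}^2+\|g_1\|_{H^k(0,T)}^2$. Then $$\|u-u_a^1\|_{L^2(\Omega_2\times(0,T))}^2\le C\big(B_2+\|g_{ad}^0\|_{L^2(0,T)}^2\big),\qquad \|u-u_{ad}^1\|_{L^2(\Omega_1\times(0,T))}^2\le C\nu^5\big(B_5+\|g_{ad}^0\|_{H^3(0,T)}^2\big),$$ $$\|u-u_a^2\|_{L^2(\Omega_2\times(0,T))}^2\le C\nu^2\big(B_5+\nu^2\|g_{ad}^0\|_{H^3(0,T)}^2\big),\qquad \|u-u_{ad}^2\|_{L^2(\Omega_1\times(0,T))}^2\le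 C\nu^8\big(B_8+\nu\|g_{ad}^0\|_{H^6(0,T)}^2\big).$$
   Context: $\Omega=(-L_1,L_2)$, $\Omega_1=(-L_1,0)$, $\Omega_2=(0,L_2)$. The operators are $$\mathcal L_{ad}=\partial_t-\nu\partial_x^2+a\partial_x+c,\quad \mathcal L_a=\partial_t+a\partial_x+c,\quad \mathcal L_{ma}=\partial_t-a\partial_x+c+\frac{a^2}{\nu},\quad \mathcal R=(\partial_t+c)^2.$$ $\mathcal C_0^\infty(X)$ denotes smooth functions with compact support in $X$ (so functions in $\mathcal C_0^\infty((0,T])$ or $\mathcal C_0^\infty(\Omega\times(0,T])$ vanish near $t=0$ but not necessarily near $t=T$). Factorization algorithm (for $a>0$): given $u_{ad}^{0}(0,\cdot)=g_{ad}^0$, for $k=1,2,\dots$ solve successively (1) $\mathcal L_a u_a^k=f$ in $\Omega_2\times(0,T)$, $u_a^k(0,\cdot)=u_{ad}^{k-1}(0,\cdot)$ on $(0,T)$, $u_a^k(\cdot,0)=h$ in $\Omega_2$; (2) $\mathcal L_{ma}u_{ma}^k=\frac{a^2}{\nu}f+\mathcal R u_a^k$ in $\Omega_2\times(0,T)$, $u_{ma}^k(L_2,\cdot)=g_2$ on $(0,T)$, $u_{ma}^k(\cdot,0)=f(\cdot,0)+\nu\, d_x^2h$ in $\Omega_2$; (3) $\mathcal L_{ad}u_{ad}^k=f$ in $\Omega_1\times(0,T)$, $u_{ad}^k(-L_1,\cdot)=g_1$ on $(0,T)$, $\mathcal L_a u_{ad}^k(0,\cdot)=u_{ma}^k(0,\cdot)$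 on $(0,T)$, $u_{ad}^k(\cdot,0)=h$ in $\Omega_1$. The constants $C,\bar\nu$ do not depend on $\nu$ or on the data $f,h,g_1,g_{ad}^0$. *)

(* Defs.v *)
From Stdlib Require Import Reals.
From Coquelicot Require Import Coquelicot.
Open Scope R_scope.

(* Functions of (x, t) are curried, space variable first. They and the functions
   of one variable are total on R and stand for their restrictions to the sets
   named in each definition: a function that is smooth up to the boundary of a
   rectangle (or of an interval) is the restriction of a smooth function on the
   plane (or on the line), and any such extension may be taken. Nothing below
   depends on the extension: at a boundary point the derivatives of an extension
   are the limits of the derivatives inside, so Derive needs no one-sided
   variant there. *)
Definition smooth1 (g : R -> R) : Prop :=
  forall (n : nat) (s : R), ex_derive_n g n s.

Definition smooth2 (u : R -> R -> R) : Prop :=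
  forall (n : nat) (x t : R), ex_diff_n u n x t.

(* C_0^oo((l, r)), extended by 0 outside (l, r). *)
Definition C0inf_open (l r : R) (h : R -> R) : Prop :=
  smooth1 h /\
  exists al be : R, l < al /\ be < r /\
    forall x : R, x < al \/ be < x -> h x = 0.

(* C_0^oo((0, T]), extended by 0 for t <= 0; the values for t > T are those of an
   arbitrary smooth extension, as g need not vanish near T. *)
Definition C0inf_time (T : R) (g : R -> R) : Prop :=
  smooth1 g /\
  exists de : R, 0 < de /\ forall t : R, t <= T -> t < de -> g t = 0.

(* C_0^oo((l, r) x (0, T]), with the same convention in t. *)
Definition C0inf_cyl (l r T : R) (f : R -> R -> R) : Prop :=
  smooth2 f /\
  exists al be de : R, l < al /\ be < r /\ 0 < de /\
    forall x t : R, t <= T -> x < al \/ be < x \/ t < de -> f x t = 0.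

Definition dx (u : R -> R -> R) (x t : R) : R := Derive (fun y => u y t) x.
Definition dxx (u : R -> R -> R) (x t : R) : R := Derive_n (fun y => u y t) 2 x.
Definition dt (u : R -> R -> R) (x t : R) : R := Derive (fun s => u x s) t.

Definition Lad (nu a c : R) (u : R -> R -> R) (x t : R) : R :=
  dt u x t - nu * dxx u x t + a * dx u x t + c * u x t.

Definition La (a c : R) (u : R -> R -> R) (x t : R) : R :=
  dt u x t + a * dx u x t + c * u x t.

Definition Lma (nu a c : R) (u : R -> R -> R) (x t : R) : R :=
  dt u x t - a * dx u x t + (c + a ^ 2 / nu) * u x t.

Definition dt_plus (c : R) (u : R -> R -> R) (x t : R) : R :=
  dt u x t + c * u x t.

Definition Rop (c : R) (u : R -> R -> R) : R -> R -> R :=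
  dt_plus c (dt_plus c u).

(* Squared norms. All integrands are continuous, so the (iterated) Riemann
   integrals are the Lebesgue integrals of the Sobolev norms. *)
Definition sqL2_1 (l r : R) (g : R -> R) : R := RInt (fun s => g s ^ 2) l r.

Definition sqH_1 (k : nat) (l r : R) (g : R -> R) : R :=
  sum_f_R0 (fun j => sqL2_1 l r (Derive_n g j)) k.

Definition sqL2_2 (l r T : R) (u : R -> R -> R) : R :=
  RInt (fun t => RInt (fun x => u x t ^ 2) l r) 0 T.

Definition sqH_2 (k : nat) (l r T : R) (u : R -> R -> R) : R :=
  sum_f_R0 (fun i =>
    sum_f_R0 (fun j => sqL2_2 l r T (partial_derive i j u)) (k - i)) k.

Definition viscous_solution (nu a c L1 L2 T : R)
    (f : R -> R -> R) (h g1 g2 : R -> R) (u : R -> R -> R) : Prop :=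
  smooth2 u /\
  (forall x t, - L1 < x < L2 -> 0 < t < T -> Lad nu a c u x t = f x t) /\
  (forall t, 0 < t < T -> u (- L1) t = g1 t) /\
  (forall t, 0 < t < T -> La a c u L2 t = g2 t) /\
  (forall x, - L1 < x < L2 -> u x 0 = h x).

Definition advection_step (a c L2 T : R)
    (f : R -> R -> R) (h gad : R -> R) (ua : R -> R -> R) : Prop :=
  smooth2 ua /\
  (forall x t, 0 < x < L2 -> 0 < t < T -> La a c ua x t = f x t) /\
  (forall t, 0 < t < T -> ua 0 t = gad t) /\
  (forall x, 0 < x < L2 -> ua x 0 = h x).

Definition modified_advection_step (nu a c L2 T : R)
    (f : R -> R -> R) (h g2 : R -> R) (ua uma : R -> R -> R) : Prop :=
  smooth2 uma /\
  (forall x t, 0 < x < L2 -> 0 < t < T ->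
     Lma nu a c uma x t = a ^ 2 / nu * f x t + Rop c ua x t) /\
  (forall t, 0 < t < T -> uma L2 t = g2 t) /\
  (forall x, 0 < x < L2 -> uma x 0 = f x 0 + nu * Derive_n h 2 x).

Definition advection_diffusion_step (nu a c L1 T : R)
    (f : R -> R -> R) (h g1 : R -> R) (uma uad : R -> R -> R) : Prop :=
  smooth2 uad /\
  (forall x t, - L1 < x < 0 -> 0 < t < T -> Lad nu a c uad x t = f x t) /\
  (forall t, 0 < t < T -> uad (- L1) t = g1 t) /\
  (forall t, 0 < t < T -> La a c uad 0 t = uma 0 t) /\
  (forall x, - L1 < x < 0 -> uad x 0 = h x).

(* One pass of the algorithm; gad is the trace at x = 0 of the previous
   advection-diffusion iterate. *)
Definition factorization_iteration (nu a c L1 L2 T : R)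
    (f : R -> R -> R) (h g1 g2 gad : R -> R) (ua uma uad : R -> R -> R) : Prop :=
  advection_step a c L2 T f h gad ua /\
  modified_advection_step nu a c L2 T f h g2 ua uma /\
  advection_diffusion_step nu a c L1 T f h g1 uma uad.

Definition data_bound (k : nat) (L1 L2 T : R)
    (f : R -> R -> R) (h g1 : R -> R) : R :=
  sqH_2 k (- L1) L2 T f + sqH_1 k (- L1) L2 h + sqH_1 k 0 T g1.

(* Main.v *)
Require Import Defs.
From Stdlib Require Import Reals Lra Lia FunctionalExtensionality.
From Coquelicot Require Import Coquelicot.
Open Scope R_scope.

(** The factorization [Lma La = (d_t + c)^2 + (a^2 / nu) Lad] shows that [La u]
    satisfies the modified advection problem with [u] in place of [u_a]. So the errors
    [ea = u - u_a], [em = La u - u_ma], [ed = u - u_ad] satisfy [La ea = nu u_xx],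
    [Lma em = (d_t + c)^2 ea] and [Lad ed = 0] with [La ed = em] at the interface.
    Energy estimates with the weight [exp (- a x / nu)] give
    [|em(0)|^2 <~ nu |(d_t + c)^2 ea|_w^2], [|ed(0)|^2 <~ nu^2 |em(0)|^2],
    [|ed|^2 <~ nu^3 |em(0)|^2] and [|ea|_w^2 <~ nu |ea(0)|^2 + nu^4 |u_xx|^2].
    Since [d_t + c] commutes with everything, the same holds for all its iterates.
    What remains is to bound [u_x] and [u_xx] uniformly in [nu]: both solve the
    viscous equation with a Robin condition (prescribed total flux) at the inflow end,
    and [u_xx] vanishes at the outflow end. *)

(** * Smooth functions and closure of identities up to the boundary *)

(** The Sobolev indices come from counting derivatives at [t = 0]. There [f] vanishes, so
    [(d_t + c) u = nu u_xx - a u_x]: every application of [d_t + c] costs two derivatives of the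
    initial data. The first pass needs [(d_t + c)^2 u] in the weighted norm, hence order
    [2 * 2 + 1 = 5]. The second needs [(d_t + c)^4 u], for which the weighted bound would ask for
    order 9. Order 8 leaves only the unweighted bound, which reads one factor [d_t + c] off the
    equation but loses a power of [nu]; this is why [B_8] lacks the factor [nu] that [g_ad^0]
    carries in the last estimate.

    The weight acts differently on the two sides. For [x < 0] it is at least 1, so weighted bounds
    control plain norms. For [x > 0] it is at most 1 and has mass at most [nu / a], so a function
    bounded pointwise in [x] has a weighted square norm of order [nu].

    Energy estimates for the iterates carry no initial term because all time derivatives of the
    errors vanish at [t = 0]: [h] is supported in [Omega_1], [f] vanishes near [t = 0], and [u],
    [u_ad] both start from [h]. As [c > 0], the energy is coercive and no Gronwall argument is
    made. *)

Lemma smooth2_continuity (u : R -> R -> R) (x t : R) :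
  smooth2 u -> continuity_2d_pt u x t.
Proof. intros H. exact (proj1 (H 0%nat x t)). Qed.

Lemma smooth2_ex_derive_x (u : R -> R -> R) (x t : R) :
  smooth2 u -> ex_derive (fun y => u y t) x.
Proof. intros H. exact (proj1 (proj2 (H 1%nat x t))). Qed.

Lemma smooth2_ex_derive_t (u : R -> R -> R) (x t : R) :
  smooth2 u -> ex_derive (fun s => u x s) t.
Proof. intros H. exact (proj1 (proj2 (proj2 (H 1%nat x t)))). Qed.

Lemma smooth2_dx (u : R -> R -> R) : smooth2 u -> smooth2 (dx u).
Proof. intros H n x t. exact (proj1 (proj2 (proj2 (proj2 (H (S n) x t))))). Qed.

Lemma smooth2_dt (u : R -> R -> R) : smooth2 u -> smooth2 (dt u).
Proof. intros H n x t. exact (proj2 (proj2 (proj2 (proj2 (H (S n) x t))))). Qed.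

Lemma dx_comb (p q : R) (u v : R -> R -> R) : smooth2 u -> smooth2 v ->
  dx (fun x t => p * u x t + q * v x t) = fun x t => p * dx u x t + q * dx v x t.
Proof.
  intros Hu Hv. apply functional_extensionality; intros x.
  apply functional_extensionality; intros t. unfold dx.
  rewrite Derive_plus, !Derive_scal; auto;
    apply ex_derive_scal; now apply smooth2_ex_derive_x.
Qed.

Lemma dt_comb (p q : R) (u v : R -> R -> R) : smooth2 u -> smooth2 v ->
  dt (fun x t => p * u x t + q * v x t) = fun x t => p * dt u x t + q * dt v x t.
Proof.
  intros Hu Hv. apply functional_extensionality; intros x.
  apply functional_extensionality; intros t. unfold dt.
  rewrite Derive_plus, !Derive_scal; auto;
    apply ex_derive_scal; now apply smooth2_ex_derive_t.
Qed.

Lemma smooth2_comb (p q : R) (u v : R -> R -> R) : smooth2 u -> smooth2 v ->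
  smooth2 (fun x t => p * u x t + q * v x t).
Proof.
  intros Hu Hv n; revert u v Hu Hv.
  induction n as [|n IH]; intros u v Hu Hv x t.
  all: assert (Hc : continuity_2d_pt (fun x t => p * u x t + q * v x t) x t)
    by (apply continuity_2d_pt_plus; apply continuity_2d_pt_mult;
        try apply continuity_2d_pt_const; now apply smooth2_continuity).
  - now split.
  - split; [exact Hc|]. split; [|split; [|split]].
    + apply @ex_derive_plus; apply ex_derive_scal; now apply smooth2_ex_derive_x.
    + apply @ex_derive_plus; apply ex_derive_scal; now apply smooth2_ex_derive_t.
    + change (ex_diff_n (dx (fun x t => p * u x t + q * v x t)) n x t).
      rewrite dx_comb by auto. apply IH; now apply smooth2_dx.
    + change (ex_diff_n (dt (fun x t => p * u x t + q * v x t)) n x t).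
      rewrite dt_comb by auto. apply IH; now apply smooth2_dt.
Qed.

Lemma dx_dt (u : R -> R -> R) : smooth2 u -> dx (dt u) = dt (dx u).
Proof.
  intros Hu. apply functional_extensionality; intros x.
  apply functional_extensionality; intros t.
  apply (Schwarz u).
  - exists (mkposreal 1 Rlt_0_1). intros y s _ _. repeat split.
    + now apply smooth2_ex_derive_x.
    + now apply smooth2_ex_derive_t.
    + apply (smooth2_ex_derive_x (dt u)). now apply smooth2_dt.
    + apply (smooth2_ex_derive_t (dx u)). now apply smooth2_dx.
  - apply (smooth2_continuity (dx (dt u))). now apply smooth2_dx, smooth2_dt.
  - apply (smooth2_continuity (dt (dx u))). now apply smooth2_dt, smooth2_dx.
Qed.

Lemma dxE (u : R -> R -> R) : dxx u = dx (dx u).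
Proof. reflexivity. Qed.

Lemma dt_plusE (c : R) (u : R -> R -> R) :
  dt_plus c u = fun x t => 1 * dt u x t + c * u x t.
Proof.
  apply functional_extensionality; intros x.
  apply functional_extensionality; intros t. unfold dt_plus. ring.
Qed.

Lemma smooth2_dt_plus (c : R) (u : R -> R -> R) :
  smooth2 u -> smooth2 (dt_plus c u).
Proof.
  intros H. rewrite dt_plusE. apply smooth2_comb; [now apply smooth2_dt|exact H].
Qed.

Lemma smooth2_dxx (u : R -> R -> R) : smooth2 u -> smooth2 (dxx u).
Proof. intros H. now apply (smooth2_dx (dx u)), smooth2_dx. Qed.

Lemma dx_dt_plus (c : R) (u : R -> R -> R) :
  smooth2 u -> dx (dt_plus c u) = dt_plus c (dx u).
Proof.
  intros H. rewrite !dt_plusE, dx_comb, dx_dt by auto using smooth2_dt. reflexivity.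
Qed.

Lemma dxx_dt_plus (c : R) (u : R -> R -> R) :
  smooth2 u -> dxx (dt_plus c u) = dt_plus c (dxx u).
Proof.
  intros H. rewrite !dxE, !dx_dt_plus by auto using smooth2_dx. reflexivity.
Qed.

Lemma dt_dt_plus (c : R) (u : R -> R -> R) :
  smooth2 u -> dt (dt_plus c u) = dt_plus c (dt u).
Proof.
  intros H. rewrite !dt_plusE, dt_comb by auto using smooth2_dt. reflexivity.
Qed.

Lemma dt_plus_comb (c p q : R) (u v : R -> R -> R) : smooth2 u -> smooth2 v ->
  dt_plus c (fun x t => p * u x t + q * v x t)
  = fun x t => p * dt_plus c u x t + q * dt_plus c v x t.
Proof.
  intros Hu Hv. unfold dt_plus. rewrite dt_comb by auto.
  apply functional_extensionality; intros x.
  apply functional_extensionality; intros t. ring.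
Qed.

(* [Lgen nu b k] covers [Lad], [La] and [Lma]. *)
Definition Lgen (nu b k : R) (u : R -> R -> R) (x t : R) : R :=
  dt u x t - nu * dxx u x t + b * dx u x t + k * u x t.

Lemma LgenE (nu b k : R) (u : R -> R -> R) :
  Lgen nu b k u = fun x t => 1 * (fun x t => 1 * dt u x t + (- nu) * dxx u x t) x t
    + 1 * (fun x t => b * dx u x t + k * u x t) x t.
Proof.
  apply functional_extensionality; intros x.
  apply functional_extensionality; intros t. unfold Lgen. ring.
Qed.

Create HintDb sm.
#[global] Hint Resolve smooth2_dt smooth2_dx smooth2_dxx smooth2_dt_plus smooth2_comb : sm.

Lemma smooth2_Lgen (nu b k : R) (u : R -> R -> R) : smooth2 u -> smooth2 (Lgen nu b k u).
Proof. intros H. rewrite LgenE. auto 10 with sm. Qed.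

#[global] Hint Resolve smooth2_Lgen : sm.

Lemma Lgen_dt_plus (c nu b k : R) (u : R -> R -> R) : smooth2 u ->
  dt_plus c (Lgen nu b k u) = Lgen nu b k (dt_plus c u).
Proof.
  intros H. rewrite !LgenE. rewrite !dt_plus_comb by auto 10 with sm.
  rewrite dx_dt_plus, dxx_dt_plus, dt_dt_plus by auto. reflexivity.
Qed.

Lemma dx_Lgen (nu b k : R) (u : R -> R -> R) : smooth2 u ->
  dx (Lgen nu b k u) = Lgen nu b k (dx u).
Proof.
  intros H. rewrite !LgenE. rewrite !dx_comb by auto 10 with sm.
  rewrite dx_dt by auto. reflexivity.
Qed.

(** * Functions of one variable and traces *)

Lemma smooth1_continuous (g : R -> R) (s : R) : smooth1 g -> continuous g s.
Proof. intros H. apply @ex_derive_continuous. exact (H 1%nat s). Qed.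


Lemma Derive_n_Derive (g : R -> R) (n : nat) (s : R) :
  Derive_n (Derive g) n s = Derive_n g (S n) s.
Proof.
  change (Derive g) with (Derive_n g 1). rewrite Derive_n_comp. f_equal. lia.
Qed.

Lemma smooth1_Derive (g : R -> R) : smooth1 g -> smooth1 (Derive g).
Proof.
  intros H n s. destruct n as [|n]; [exact I|].
  apply (ex_derive_ext (Derive_n g (S n))); [|exact (H (S (S n)) s)].
  intros t. symmetry. apply Derive_n_Derive.
Qed.

Lemma Derive_comb (p q : R) (g h : R -> R) : smooth1 g -> smooth1 h ->
  Derive (fun s => p * g s + q * h s) = fun s => p * Derive g s + q * Derive h s.
Proof.
  intros Hg Hh. apply functional_extensionality; intros s.
  rewrite Derive_plus, !Derive_scal; auto; apply ex_derive_scal;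
    [exact (Hg 1%nat s) | exact (Hh 1%nat s)].
Qed.

Lemma Derive_n_comb (p q : R) (g h : R -> R) (n : nat) : smooth1 g -> smooth1 h ->
  Derive_n (fun s => p * g s + q * h s) n
  = fun s => p * Derive_n g n s + q * Derive_n h n s.
Proof.
  revert g h. induction n as [|n IH]; intros g h Hg Hh; [reflexivity|].
  apply functional_extensionality; intros s.
  rewrite <- Derive_n_Derive, Derive_comb by auto.
  rewrite IH by now apply smooth1_Derive. now rewrite !Derive_n_Derive.
Qed.

Lemma smooth1_comb (p q : R) (g h : R -> R) : smooth1 g -> smooth1 h ->
  smooth1 (fun s => p * g s + q * h s).
Proof.
  intros Hg Hh [|n] s; [exact I|]. simpl.
  rewrite Derive_n_comb by auto.
  apply @ex_derive_plus; apply ex_derive_scal;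
    [exact (Hg (S n) s) | exact (Hh (S n) s)].
Qed.

Definition D_plus (c : R) (g : R -> R) (t : R) : R := Derive g t + c * g t.

Lemma D_plusE (c : R) (g : R -> R) : D_plus c g = fun t => 1 * Derive g t + c * g t.
Proof. apply functional_extensionality; intros t. unfold D_plus. ring. Qed.

Lemma smooth1_D_plus (c : R) (g : R -> R) : smooth1 g -> smooth1 (D_plus c g).
Proof.
  intros H. rewrite D_plusE. apply smooth1_comb; [now apply smooth1_Derive | exact H].
Qed.

Lemma smooth1_trace_t (u : R -> R -> R) (x : R) : smooth2 u -> smooth1 (fun t => u x t).
Proof.
  intros Hu n. revert u Hu. induction n as [|n IH]; intros u Hu s; [exact I|].
  destruct n as [|n]; [now apply smooth2_ex_derive_t|].
  apply (ex_derive_ext (Derive_n (fun t => dt u x t) n)); [|exact (IH (dt u) (smooth2_dt u Hu) s)].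
  intros t. apply (Derive_n_Derive (fun t => u x t)).
Qed.

Lemma smooth1_trace_x (u : R -> R -> R) (t : R) : smooth2 u -> smooth1 (fun x => u x t).
Proof.
  intros Hu n. revert u Hu. induction n as [|n IH]; intros u Hu s; [exact I|].
  destruct n as [|n]; [now apply smooth2_ex_derive_x|].
  apply (ex_derive_ext (Derive_n (fun x => dx u x t) n)); [|exact (IH (dx u) (smooth2_dx u Hu) s)].
  intros x. apply (Derive_n_Derive (fun x => u x t)).
Qed.

(* Identities are needed up to the boundary, but the problems are posed on open sets. *)
Definition eqI (l r : R) (g h : R -> R) : Prop := forall s, l <= s <= r -> g s = h s.

Definition eqR (l r T : R) (u v : R -> R -> R) : Prop :=
  forall x t, l <= x <= r -> 0 <= t <= T -> u x t = v x t.

Lemma zero_closure (l r : R) (g : R -> R) : l < r ->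
  (forall s, l <= s <= r -> continuous g s) ->
  (forall s, l < s < r -> g s = 0) -> forall s, l <= s <= r -> g s = 0.
Proof.
  intros Hlr Hc H s Hs.
  destruct (Req_dec (g s) 0) as [|Hn]; [assumption|exfalso].
  destruct (proj1 (filterlim_locally g (g s)) (Hc s Hs) (mkposreal _ (Rabs_pos_lt _ Hn)))
    as [d Hd].
  assert (Hd0 := cond_pos d).
  (* Moving [s] towards the farther end by at most a quarter of the length gives a point of the open
     interval close to [s], where [g] vanishes although it must stay within [Rabs (g s)] of
     [g s]. *)
  assert (Hy : exists y, l < y < r /\ Rabs (y - s) < d).
  { destruct (Rle_lt_dec s ((l + r) / 2)).
    - exists (s + Rmin (d / 2) ((r - l) / 4)).
      pose proof (Rmin_l (d / 2) ((r - l) / 4)). pose proof (Rmin_r (d / 2) ((r - l) / 4)).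
      pose proof (Rmin_pos (d / 2) ((r - l) / 4) ltac:(lra) ltac:(lra)).
      split; [lra|]. rewrite Rabs_pos_eq; lra.
    - exists (s - Rmin (d / 2) ((r - l) / 4)).
      pose proof (Rmin_l (d / 2) ((r - l) / 4)). pose proof (Rmin_r (d / 2) ((r - l) / 4)).
      pose proof (Rmin_pos (d / 2) ((r - l) / 4) ltac:(lra) ltac:(lra)).
      split; [lra|]. rewrite Rabs_left; lra. }
  destruct Hy as [y [Hy1 Hy2]].
  specialize (Hd y Hy2). change (Rabs (g y - g s) < Rabs (g s)) in Hd.
  rewrite (H y Hy1) in Hd. rewrite Rminus_0_l, Rabs_Ropp in Hd. lra.
Qed.

Lemma eqI_of_open (l r : R) (g h : R -> R) : l < r -> smooth1 g -> smooth1 h ->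
  (forall s, l < s < r -> g s = h s) -> eqI l r g h.
Proof.
  intros Hlr Hg Hh H s Hs.
  assert (1 * g s + (-1) * h s = 0); [|lra].
  apply (zero_closure l r (fun s => 1 * g s + (-1) * h s)); auto.
  - intros y _. apply smooth1_continuous. now apply smooth1_comb.
  - intros y Hy. rewrite (H y Hy). ring.
Qed.

Lemma eqR_of_open (l r T : R) (u v : R -> R -> R) : l < r -> 0 < T ->
  smooth2 u -> smooth2 v ->
  (forall x t, l < x < r -> 0 < t < T -> u x t = v x t) -> eqR l r T u v.
Proof.
  intros Hlr HT Hu Hv H x t Hx Ht.
  apply (eqI_of_open l r (fun x => u x t) (fun x => v x t)); auto using smooth1_trace_x.
  clear x Hx. intros x Hx.
  apply (eqI_of_open 0 T (fun t => u x t) (fun t => v x t)); auto using smooth1_trace_t.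
Qed.

Lemma locally_open_interval (l r s : R) (P : R -> Prop) :
  l < s < r -> (forall y, l < y < r -> P y) -> locally s P.
Proof.
  intros Hs H.
  apply (locally_interval P s l r); simpl; try tauto.
  intros y H1 H2. now apply H.
Qed.

(** [Derive] is two-sided, so equality on the interval determines it directly only at interior
    points; the end points follow by continuity of both derivatives. This is what allows the
    equations and boundary conditions to be differentiated up to the boundary. *)
Lemma eqI_Derive (l r : R) (g h : R -> R) : l < r -> smooth1 g -> smooth1 h ->
  eqI l r g h -> eqI l r (Derive g) (Derive h).
Proof.
  intros Hlr Hg Hh H. apply eqI_of_open; auto using smooth1_Derive.
  intros s Hs. apply Derive_ext_loc, (locally_open_interval l r); auto.
  intros y Hy. apply H. lra.
Qed.

Lemma eqI_D_plus (c l r : R) (g h : R -> R) : l < r -> smooth1 g -> smooth1 h ->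
  eqI l r g h -> eqI l r (D_plus c g) (D_plus c h).
Proof.
  intros Hlr Hg Hh H s Hs. unfold D_plus.
  rewrite (H s Hs), (eqI_Derive l r g h Hlr Hg Hh H s Hs). reflexivity.
Qed.

Lemma eqR_dx (l r T : R) (u v : R -> R -> R) : l < r -> smooth2 u -> smooth2 v ->
  eqR l r T u v -> eqR l r T (dx u) (dx v).
Proof.
  intros Hlr Hu Hv H x t Hx Ht.
  apply (eqI_Derive l r (fun x => u x t) (fun x => v x t)); auto using smooth1_trace_x.
  intros y Hy. now apply H.
Qed.

Lemma eqR_dt_plus (c l r T : R) (u v : R -> R -> R) : 0 < T -> smooth2 u -> smooth2 v ->
  eqR l r T u v -> eqR l r T (dt_plus c u) (dt_plus c v).
Proof.
  intros HT Hu Hv H x t Hx Ht.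
  apply (eqI_D_plus c 0 T (fun t => u x t) (fun t => v x t)); auto using smooth1_trace_t.
  intros s Hs. now apply H.
Qed.

(** * Iterated integrals of continuous functions *)

Definition Cont1 (g : R -> R) : Prop := forall s, continuous g s.
Definition Cont2 (F : R -> R -> R) : Prop := forall x t, continuity_2d_pt F x t.

Lemma Cont1_ex_RInt (g : R -> R) (l r : R) : Cont1 g -> ex_RInt g l r.
Proof. intros H. apply @ex_RInt_continuous. intros s _. apply H. Qed.

Lemma Cont1_const (k : R) : Cont1 (fun _ => k).
Proof. intros s. apply @continuous_const. Qed.

Lemma Cont1_plus (g h : R -> R) : Cont1 g -> Cont1 h -> Cont1 (fun s => g s + h s).
Proof. intros Hg Hh s. apply @continuous_plus; auto. Qed.

Lemma Cont1_minus (g h : R -> R) : Cont1 g -> Cont1 h -> Cont1 (fun s => g s - h s).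
Proof. intros Hg Hh s. apply @continuous_minus; auto. Qed.

Lemma Cont1_mult (g h : R -> R) : Cont1 g -> Cont1 h -> Cont1 (fun s => g s * h s).
Proof. intros Hg Hh s. apply @continuous_mult; auto. Qed.

Lemma Cont1_sqr (g : R -> R) : Cont1 g -> Cont1 (fun s => g s ^ 2).
Proof. intros H. simpl. auto using Cont1_mult, Cont1_const. Qed.

Lemma Cont1_smooth (g : R -> R) : smooth1 g -> Cont1 g.
Proof. intros H s. now apply smooth1_continuous. Qed.

Lemma Cont1_exp (k : R) : Cont1 (fun s => exp (k * s)).
Proof.
  intros s. apply @ex_derive_continuous. auto_derive. exact I.
Qed.

Lemma Cont2_const (k : R) : Cont2 (fun _ _ => k).
Proof. intros x t. apply continuity_2d_pt_const. Qed.

Lemma Cont2_plus (F G : R -> R -> R) : Cont2 F -> Cont2 G -> Cont2 (fun x t => F x t + G x t).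
Proof. intros HF HG x t. now apply continuity_2d_pt_plus. Qed.

Lemma Cont2_minus (F G : R -> R -> R) : Cont2 F -> Cont2 G -> Cont2 (fun x t => F x t - G x t).
Proof. intros HF HG x t. now apply continuity_2d_pt_minus. Qed.

Lemma Cont2_mult (F G : R -> R -> R) : Cont2 F -> Cont2 G -> Cont2 (fun x t => F x t * G x t).
Proof. intros HF HG x t. now apply continuity_2d_pt_mult. Qed.

Lemma Cont2_sqr (F : R -> R -> R) : Cont2 F -> Cont2 (fun x t => F x t ^ 2).
Proof. intros H. simpl. auto using Cont2_mult, Cont2_const. Qed.

Lemma Cont2_smooth (u : R -> R -> R) : smooth2 u -> Cont2 u.
Proof. intros H x t. now apply smooth2_continuity. Qed.

Lemma Cont2_lift_x (g : R -> R) : Cont1 g -> Cont2 (fun x _ => g x).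
Proof.
  intros H x t. apply (continuity_1d_2d_pt_comp g (fun x _ => x)).
  - apply continuity_pt_filterlim, H.
  - apply continuity_2d_pt_id1.
Qed.

Lemma Cont2_lift_t (g : R -> R) : Cont1 g -> Cont2 (fun _ t => g t).
Proof.
  intros H x t. apply (continuity_1d_2d_pt_comp g (fun _ t => t)).
  - apply continuity_pt_filterlim, H.
  - apply continuity_2d_pt_id2.
Qed.

Lemma Cont2_slice_t (F : R -> R -> R) (x : R) : Cont2 F -> Cont1 (fun t => F x t).
Proof.
  intros H t. apply filterlim_locally. intros eps.
  destruct (H x t eps) as [d Hd]. exists d. intros s Hs.
  apply Hd; [|exact Hs]. rewrite Rminus_eq_0, Rabs_R0. apply cond_pos.
Qed.

Lemma Cont2_slice_x (F : R -> R -> R) (t : R) : Cont2 F -> Cont1 (fun x => F x t).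
Proof.
  intros H x. apply filterlim_locally. intros eps.
  destruct (H x t eps) as [d Hd]. exists d. intros y Hy.
  apply Hd; [exact Hy|]. rewrite Rminus_eq_0, Rabs_R0. apply cond_pos.
Qed.

(** Uniform continuity on the compact rectangle over [[t - 1, t + 1]]. The tolerance is halved
    because the integral bound is only nonstrict. *)
Lemma Cont1_RInt_param (F : R -> R -> R) (l r : R) : l < r -> Cont2 F ->
  Cont1 (fun t => RInt (fun x => F x t) l r).
Proof.
  intros Hlr H t. apply filterlim_locally. intros eps.
  assert (He : 0 < eps / (2 * (r - l))).
  { apply Rdiv_lt_0_compat; [apply cond_pos | lra]. }
  destruct (uniform_continuity_2d F l r (t - 1) (t + 1)
    (fun x s _ _ => H x s) (mkposreal _ He)) as [d Hd].
  assert (Hm : 0 < Rmin d 1) by (apply Rmin_pos; [apply cond_pos | lra]).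
  exists (mkposreal _ Hm). intros s Hs.
  change (Rabs (s - t) < Rmin d 1) in Hs.
  assert (Hs1 := Rlt_le_trans _ _ _ Hs (Rmin_l _ _)).
  assert (Hs2 := Rlt_le_trans _ _ _ Hs (Rmin_r _ _)).
  apply Rabs_def2 in Hs2.
  change (Rabs (RInt (fun x => F x s) l r - RInt (fun x => F x t) l r) < eps).
  rewrite <- (RInt_minus (V := R_CompleteNormedModule))
    by (apply Cont1_ex_RInt; now apply Cont2_slice_x).
  apply Rle_lt_trans with ((r - l) * (eps / (2 * (r - l)))).
  - apply abs_RInt_le_const; [lra | |].
    + apply Cont1_ex_RInt. apply Cont1_minus; now apply Cont2_slice_x.
    + intros x Hx. left. apply (Hd x t x s); try lra.
      rewrite Rminus_eq_0, Rabs_R0. apply cond_pos.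
  - assert (Hp := cond_pos eps). replace ((r - l) * (eps / (2 * (r - l)))) with (eps / 2).
    + lra.
    + field. lra.
Qed.

Ltac sm := auto 20 with sm.

Ltac ct_step :=
  match goal with
  | |- Cont2 (fun _ _ => ?k) => apply (Cont2_const k)
  | |- Cont2 (fun x t => @?F x t + @?G x t) => apply (Cont2_plus F G)
  | |- Cont2 (fun x t => @?F x t - @?G x t) => apply (Cont2_minus F G)
  | |- Cont2 (fun x t => @?F x t * @?G x t) => apply (Cont2_mult F G)
  | |- Cont2 (fun x t => @?F x t ^ 2) => apply (Cont2_sqr F)
  | |- Cont2 (fun x _ => @?g x) => apply (Cont2_lift_x g)
  | |- Cont2 (fun _ t => @?g t) => apply (Cont2_lift_t g)
  | |- Cont1 (fun _ => ?k) => apply (Cont1_const k)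
  | |- Cont1 (fun s => @?g s + @?h s) => apply (Cont1_plus g h)
  | |- Cont1 (fun s => @?g s - @?h s) => apply (Cont1_minus g h)
  | |- Cont1 (fun s => @?g s * @?h s) => apply (Cont1_mult g h)
  | |- Cont1 (fun s => @?g s ^ 2) => apply (Cont1_sqr g)
  | |- Cont1 (fun s => exp (?k * s)) => apply (Cont1_exp k)
  | H : Cont1 ?g |- Cont1 (fun t => ?g t) => exact H
  | H : smooth1 ?g |- Cont1 (fun t => ?g t) => exact (Cont1_smooth g H)
  | |- Cont1 (fun t => ?F ?x t) => apply (Cont2_slice_t F x)
  | |- Cont1 (fun x => ?F x ?t) => apply (Cont2_slice_x F t)
  | |- Cont1 (?F ?x) => apply (Cont2_slice_t F x)
  | H : Cont2 ?F |- Cont2 ?F => exact H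
  | H : Cont2 ?F |- Cont2 (fun x t => ?F x t) => exact H
  | |- Cont2 (fun x t => ?u x t) => change (Cont2 u)
  | |- Cont2 ?u => apply (Cont2_smooth u); solve [sm]
  end.
Ltac ct := repeat ct_step; auto.

Definition I2 (l r T : R) (F : R -> R -> R) : R :=
  RInt (fun t => RInt (fun x => F x t) l r) 0 T.

Lemma RInt_plus_Cont1 (g h : R -> R) (l r : R) : Cont1 g -> Cont1 h ->
  RInt (fun s => g s + h s) l r = RInt g l r + RInt h l r.
Proof. intros Hg Hh. apply (RInt_plus (V := R_CompleteNormedModule)); now apply Cont1_ex_RInt. Qed.

Lemma RInt_minus_Cont1 (g h : R -> R) (l r : R) : Cont1 g -> Cont1 h ->
  RInt (fun s => g s - h s) l r = RInt g l r - RInt h l r.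
Proof. intros Hg Hh. apply (RInt_minus (V := R_CompleteNormedModule)); now apply Cont1_ex_RInt. Qed.

Lemma RInt_scal_Cont1 (k : R) (g : R -> R) (l r : R) : Cont1 g ->
  RInt (fun s => k * g s) l r = k * RInt g l r.
Proof. intros Hg. apply (RInt_scal (V := R_CompleteNormedModule)); now apply Cont1_ex_RInt. Qed.

Lemma RInt_le_Cont1 (g h : R -> R) (l r : R) : l <= r -> Cont1 g -> Cont1 h ->
  (forall s, l < s < r -> g s <= h s) -> RInt g l r <= RInt h l r.
Proof. intros Hlr Hg Hh H. apply RInt_le; auto using Cont1_ex_RInt. Qed.

Lemma RInt_ext_open (g h : R -> R) (l r : R) : l <= r ->
  (forall s, l < s < r -> g s = h s) -> RInt g l r = RInt h l r.
Proof.
  intros Hlr H. apply RInt_ext. intros s Hs.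
  rewrite Rmin_left, Rmax_right in Hs by lra. now apply H.
Qed.

Lemma RInt_zero (l r : R) : RInt (fun _ => 0) l r = 0.
Proof. rewrite RInt_const. apply Rmult_0_r. Qed.

Lemma RInt_nonneg (g : R -> R) (l r : R) : l <= r -> Cont1 g ->
  (forall s, l < s < r -> 0 <= g s) -> 0 <= RInt g l r.
Proof.
  intros Hlr Hg H. rewrite <- (RInt_zero l r). apply RInt_le_Cont1; ct.
Qed.

Section Rectangle.
Context (l r T : R) (Hlr : l < r) (HT : 0 < T).

Lemma I2_plus (F G : R -> R -> R) : Cont2 F -> Cont2 G ->
  I2 l r T (fun x t => F x t + G x t) = I2 l r T F + I2 l r T G.
Proof.
  intros HF HG. unfold I2.
  rewrite <- RInt_plus_Cont1 by now apply Cont1_RInt_param.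
  apply RInt_ext. intros t _. apply RInt_plus_Cont1; now apply Cont2_slice_x.
Qed.

Lemma I2_scal (k : R) (F : R -> R -> R) : Cont2 F ->
  I2 l r T (fun x t => k * F x t) = k * I2 l r T F.
Proof.
  intros HF. unfold I2. rewrite <- RInt_scal_Cont1 by now apply Cont1_RInt_param.
  apply RInt_ext. intros t _. apply RInt_scal_Cont1; now apply Cont2_slice_x.
Qed.

Lemma I2_ext (F G : R -> R -> R) :
  (forall x t, l < x < r -> 0 < t < T -> F x t = G x t) -> I2 l r T F = I2 l r T G.
Proof.
  intros H. unfold I2. apply RInt_ext_open; [lra|]. intros t Ht.
  apply RInt_ext_open; [lra|]. intros x Hx. now apply H.
Qed.

Lemma I2_le (F G : R -> R -> R) : Cont2 F -> Cont2 G ->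
  (forall x t, l < x < r -> 0 < t < T -> F x t <= G x t) -> I2 l r T F <= I2 l r T G.
Proof.
  intros HF HG H. unfold I2. apply RInt_le_Cont1; [lra| | |];
    try now apply Cont1_RInt_param.
  intros t Ht. apply RInt_le_Cont1; [lra| | |]; try now apply Cont2_slice_x.
  intros x Hx. now apply H.
Qed.

Lemma I2_nonneg (F : R -> R -> R) : Cont2 F ->
  (forall x t, l < x < r -> 0 < t < T -> 0 <= F x t) -> 0 <= I2 l r T F.
Proof.
  intros HF H. unfold I2. apply RInt_nonneg; [lra| |].
  - now apply Cont1_RInt_param.
  - intros t Ht. apply RInt_nonneg; [lra| |]; [now apply Cont2_slice_x|].
    intros x Hx. now apply H.
Qed.

Lemma I2_derive_x (G F : R -> R -> R) : Cont2 F ->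
  (forall x t, is_derive (fun y => G y t) x (F x t)) ->
  I2 l r T F = RInt (fun t => G r t - G l t) 0 T.
Proof.
  intros HF HG. apply RInt_ext. intros t _.
  rewrite <- (RInt_Derive (fun x => G x t)).
  - apply RInt_ext. intros x _. symmetry. apply is_derive_unique, HG.
  - intros x _. eexists. apply HG.
  - intros x _. apply (continuous_ext (fun x => F x t)).
    + intros y. symmetry. apply is_derive_unique, HG.
    + now apply Cont2_slice_x.
Qed.

(** Time is the outer variable of [I2], so in contrast with the [x] version the derivative first has
    to be taken out of the inner integral; this replaces Fubini. *)
Lemma I2_derive_t (G F : R -> R -> R) : Cont2 F -> Cont2 G ->
  (forall x t, is_derive (fun s => G x s) t (F x t)) ->
  I2 l r T F = RInt (fun x => G x T) l r - RInt (fun x => G x 0) l r.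
Proof.
  intros HF HG HD.
  assert (HE : forall x t, Derive (fun s => G x s) t = F x t)
    by (intros; apply is_derive_unique, HD).
  assert (Hd : forall t, is_derive (fun t => RInt (fun x => G x t) l r) t
    (RInt (fun x => F x t) l r)).
  { intros t. rewrite (RInt_ext _ (fun x => Derive (fun s => G x s) t))
      by (intros; now rewrite HE).
    apply (is_derive_RInt_param (fun t x => G x t)).
    - exists (mkposreal 1 Rlt_0_1). intros s _ x _. eexists. apply HD.
    - intros x _. apply (continuity_2d_pt_ext (fun t x => F x t)).
      + intros; now rewrite HE.
      + intros eps. destruct (HF x t eps) as [d Hd]. exists d.
        intros; now apply Hd.
    - exists (mkposreal 1 Rlt_0_1). intros s _. apply Cont1_ex_RInt. now apply Cont2_slice_x. }
  rewrite <- (RInt_Derive (fun t => RInt (fun x => G x t) l r)).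
  - apply RInt_ext. intros t _. symmetry. apply is_derive_unique, Hd.
  - intros t _. eexists. apply Hd.
  - intros t _. apply (continuous_ext (fun t => RInt (fun x => F x t) l r)).
    + intros s. symmetry. apply is_derive_unique, Hd.
    + now apply Cont1_RInt_param.
Qed.

End Rectangle.

(** * Energy estimates *)

Section Energy.
Context (l r T : R) (Hlr : l < r) (HT : 0 < T).

Lemma is_derive_dx (w : R -> R -> R) (x t : R) : smooth2 w ->
  is_derive (fun y => w y t) x (dx w x t).
Proof. intros H. apply Derive_correct. now apply smooth2_ex_derive_x. Qed.

Lemma is_derive_dt (w : R -> R -> R) (x t : R) : smooth2 w ->
  is_derive (fun s => w x s) t (dt w x t).
Proof. intros H. apply Derive_correct. now apply smooth2_ex_derive_t. Qed.

Definition wsq (lam : R) (u : R -> R -> R) : R :=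
  I2 l r T (fun x t => exp (- lam * x) * u x t ^ 2).

(** The boundary term at [x], integrated in time, that is left when [Lgen] is multiplied by
    [exp (- lam * x) * w] and integrated by parts in [x]. *)
Definition flux (nu b lam : R) (w : R -> R -> R) (x : R) : R :=
  exp (- lam * x) * RInt (fun t => (b - nu * lam) / 2 * w x t ^ 2
    - nu * (w x t * dx w x t)) 0 T.

(** Differentiating the weight creates the damping [b * lam / 2 - nu * lam ^ 2 / 2]. Two choices
    matter later. Without diffusion a weight decaying along the transport direction only adds
    damping. With diffusion and [lam = b / nu], both this extra damping and the coefficient of
    [w ^ 2] in the flux vanish, so that only the diffusive flux remains at the boundary. *)
Lemma energy_identity (nu b k lam : R) (w : R -> R -> R) : smooth2 w ->
  I2 l r T (fun x t => exp (- lam * x) * (w x t * Lgen nu b k w x t))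
  = / 2 * (RInt (fun x => exp (- lam * x) * w x T ^ 2) l r
           - RInt (fun x => exp (- lam * x) * w x 0 ^ 2) l r)
    + (flux nu b lam w r - flux nu b lam w l)
    + nu * wsq lam (dx w)
    + (k + b * lam / 2 - nu * lam ^ 2 / 2) * wsq lam w.
Proof.
  intros Hw.
  assert (Hx : forall x t, is_derive (fun y => w y t) x (dx w x t))
    by (intros; now apply is_derive_dx).
  assert (Hxx : forall x t, is_derive (fun y => dx w y t) x (dxx w x t))
    by (intros; apply (is_derive_dx (dx w)); now apply smooth2_dx).
  assert (Ht : forall x t, is_derive (fun s => w x s) t (dt w x t))
    by (intros; now apply is_derive_dt).
  (* The integrand is split into the exact derivatives [Ft = d_t Gt] and [Fx = d_x Gx] plus the two
     quadratic terms of the conclusion. *)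
  set (Ft := fun x t => exp (- lam * x) * (w x t * dt w x t)).
  set (Fx := fun x t => exp (- lam * x) * ((b - nu * lam) * (w x t * dx w x t)
     - nu * (dx w x t ^ 2 + w x t * dxx w x t)
     - lam * ((b - nu * lam) / 2 * w x t ^ 2 - nu * (w x t * dx w x t)))).
  set (Gt := fun x t => exp (- lam * x) * (/ 2 * w x t ^ 2)).
  set (Gx := fun x t => exp (- lam * x) * ((b - nu * lam) / 2 * w x t ^ 2
     - nu * (w x t * dx w x t))).
  assert (HFt : Cont2 Ft) by (unfold Ft; ct).
  assert (HFx : Cont2 Fx) by (unfold Fx; ct).
  assert (HGt : Cont2 Gt) by (unfold Gt; ct).
  assert (E1 : I2 l r T Ft = RInt (fun x => Gt x T) l r - RInt (fun x => Gt x 0) l r).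
  { apply I2_derive_t; auto. intros x t. unfold Gt, Ft. auto_derive.
    - repeat split; eexists; apply Ht.
    - change (Derive (fun s => w x s) t) with (dt w x t). field. }
  assert (E2 : I2 l r T Fx = RInt (fun t => Gx r t - Gx l t) 0 T).
  { apply I2_derive_x; auto. intros x t. unfold Gx, Fx. auto_derive.
    - repeat split; match goal with
      | |- context [dx w] => apply (smooth2_ex_derive_x (dx w)); sm
      | _ => now apply (smooth2_ex_derive_x w)
      end.
    - change (Derive (fun y => w y t) x) with (dx w x t).
      change (Derive (fun y => dx w y t) x) with (dxx w x t). field. }
  assert (E3 : forall s, RInt (fun x => Gt x s) l r
     = / 2 * RInt (fun x => exp (- lam * x) * w x s ^ 2) l r).
  { intros s. rewrite <- RInt_scal_Cont1 by ct.
    apply RInt_ext_open; [lra|]. intros x _. unfold Gt. ring. }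
  assert (E4 : forall x, RInt (fun t => Gx x t) 0 T = flux nu b lam w x).
  { intros x. unfold Gx, flux. rewrite <- RInt_scal_Cont1 by ct. reflexivity. }
  rewrite RInt_minus_Cont1 in E2 by (unfold Gx; ct).
  rewrite !E3 in E1. rewrite !E4 in E2.
  rewrite (I2_ext l r T Hlr HT _ (fun x t => Ft x t + (Fx x t + (nu * (exp (- lam * x) * dx w x t ^ 2)
    + (k + b * lam / 2 - nu * lam ^ 2 / 2) * (exp (- lam * x) * w x t ^ 2))))).
  2:{ intros x t _ _. unfold Ft, Fx, Lgen. field. }
  rewrite I2_plus by ct. rewrite I2_plus by ct. rewrite I2_plus by ct.
  rewrite E1, E2. rewrite !I2_scal by ct. unfold wsq. ring.
Qed.

End Energy.

Lemma young (mu p q : R) : 0 < mu -> p * q <= mu / 2 * p ^ 2 + / (2 * mu) * q ^ 2.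
Proof.
  intros Hmu.
  assert (H : mu / 2 * p ^ 2 + / (2 * mu) * q ^ 2 - p * q = / (2 * mu) * (mu * p - q) ^ 2)
    by (field; lra).
  assert (0 < / (2 * mu)) by (apply Rinv_0_lt_compat; lra).
  pose proof (pow2_ge_0 (mu * p - q)). nra.
Qed.

Lemma RInt_young (mu l r : R) (g h : R -> R) : 0 < mu -> l <= r -> Cont1 g -> Cont1 h ->
  RInt (fun s => g s * h s) l r
  <= mu / 2 * RInt (fun s => g s ^ 2) l r + / (2 * mu) * RInt (fun s => h s ^ 2) l r.
Proof.
  intros Hmu Hlr Hg Hh.
  rewrite <- !RInt_scal_Cont1, <- RInt_plus_Cont1 by ct.
  apply RInt_le_Cont1; ct. intros s _. now apply young.
Qed.

Lemma RInt_sqr_nonneg (l r : R) (g : R -> R) : l <= r -> Cont1 g ->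
  0 <= RInt (fun s => g s ^ 2) l r.
Proof. intros. apply RInt_nonneg; ct. intros. apply pow2_ge_0. Qed.

Lemma RInt_wsqr_nonneg (lam l r : R) (g : R -> R) : l <= r -> Cont1 g ->
  0 <= RInt (fun s => exp (lam * s) * g s ^ 2) l r.
Proof.
  intros. apply RInt_nonneg; ct. intros s _.
  apply Rmult_le_pos; [left; apply exp_pos | apply pow2_ge_0].
Qed.

Section WeightedNorm.
Context (l r T : R) (Hlr : l < r) (HT : 0 < T).

Lemma wsq_nonneg (lam : R) (u : R -> R -> R) : Cont2 u -> 0 <= wsq l r T lam u.
Proof.
  intros H. apply I2_nonneg; ct. intros x t _ _.
  apply Rmult_le_pos; [left; apply exp_pos | apply pow2_ge_0].
Qed.

Lemma wsq_young (lam mu : R) (u v : R -> R -> R) : 0 < mu -> Cont2 u -> Cont2 v ->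
  I2 l r T (fun x t => exp (- lam * x) * (u x t * v x t))
  <= mu / 2 * wsq l r T lam u + / (2 * mu) * wsq l r T lam v.
Proof.
  intros Hmu Hu Hv. unfold wsq.
  rewrite <- !I2_scal, <- I2_plus by ct. apply I2_le; ct.
  intros x t _ _. pose proof (young mu (u x t) (v x t) Hmu).
  pose proof (exp_pos (- lam * x)). nra.
Qed.

Lemma wsq_comb (lam p q : R) (u v : R -> R -> R) : Cont2 u -> Cont2 v ->
  wsq l r T lam (fun x t => p * u x t + q * v x t)
  <= 2 * p ^ 2 * wsq l r T lam u + 2 * q ^ 2 * wsq l r T lam v.
Proof.
  intros Hu Hv. unfold wsq. rewrite <- !I2_scal, <- I2_plus by ct. apply I2_le; ct.
  intros x t _ _. pose proof (exp_pos (- lam * x)).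
  pose proof (pow2_ge_0 (p * u x t - q * v x t)). nra.
Qed.

Lemma wsq_scal (lam p : R) (u : R -> R -> R) : Cont2 u ->
  wsq l r T lam (fun x t => p * u x t) = p ^ 2 * wsq l r T lam u.
Proof.
  intros Hu. unfold wsq. rewrite <- I2_scal by ct. apply I2_ext; auto.
  intros x t _ _. ring.
Qed.

Lemma wsq_0 (u : R -> R -> R) : wsq l r T 0 u = sqL2_2 l r T u.
Proof.
  apply (I2_ext l r T Hlr HT). intros x t _ _.
  rewrite Ropp_0, Rmult_0_l, exp_0. ring.
Qed.

(** The energy at time [T] is nonnegative and is dropped, which turns the identity into an
    inequality. *)
Lemma energy_zero_initial (nu b k lam : R) (w F : R -> R -> R) :
  smooth2 w -> eqR l r T (Lgen nu b k w) F -> (forall x, l <= x <= r -> w x 0 = 0) ->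
  flux T nu b lam w r - flux T nu b lam w l + nu * wsq l r T lam (dx w)
  + (k + b * lam / 2 - nu * lam ^ 2 / 2) * wsq l r T lam w
  <= I2 l r T (fun x t => exp (- lam * x) * (w x t * F x t)).
Proof.
  intros Hw HF H0.
  rewrite (I2_ext l r T Hlr HT _ (fun x t => exp (- lam * x) * (w x t * Lgen nu b k w x t))).
  2:{ intros x t Hx Ht. rewrite <- HF by lra. reflexivity. }
  rewrite energy_identity by auto.
  rewrite (RInt_ext_open (fun x => exp (- lam * x) * w x 0 ^ 2) (fun _ => 0)).
  2: lra. 2:{ intros x Hx. rewrite H0 by lra. ring. }
  rewrite RInt_zero.
  pose proof (RInt_wsqr_nonneg (- lam) l r (fun x => w x T) (Rlt_le _ _ Hlr) ltac:(ct)).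
  lra.
Qed.

End WeightedNorm.

(** * Estimates for the transport and the viscous problems *)

Lemma flux_advection (T b lam : R) (w : R -> R -> R) (x : R) : smooth2 w ->
  flux T 0 b lam w x = exp (- lam * x) * (b / 2 * RInt (fun t => w x t ^ 2) 0 T).
Proof.
  intros Hw. unfold flux. rewrite <- (RInt_scal_Cont1 (b / 2)) by ct. f_equal.
  f_equal. apply functional_extensionality. intros t. field.
Qed.

(** The weight raises the damping from [c] to [mu = c + a * lam / 2]. Half of it absorbs the source
    by Young's inequality, and the outflow term at [L] has a favourable sign. With [lam = 0] this is
    the plain estimate; a large [lam] makes both constants small. *)
Lemma advection_estimate (a c L T lam : R) (w F : R -> R -> R) :
  0 < a -> 0 < c -> 0 < L -> 0 < T -> 0 <= lam ->
  smooth2 w -> smooth2 F -> eqR 0 L T (Lgen 0 a c w) F ->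
  (forall x, 0 <= x <= L -> w x 0 = 0) ->
  wsq 0 L T lam w <= a / (c + a * lam / 2) * RInt (fun t => w 0 t ^ 2) 0 T
    + / (c + a * lam / 2) ^ 2 * wsq 0 L T lam F.
Proof.
  intros Ha Hc HL HT Hlam Hw HF Heq H0.
  pose proof (energy_zero_initial 0 L T HL HT 0 a c lam w F Hw Heq H0) as HE.
  rewrite !flux_advection, Rmult_0_r, exp_0 in HE by auto.
  pose proof (RInt_sqr_nonneg 0 T (fun t => w L t) (Rlt_le _ _ HT) ltac:(ct)) as HB.
  set (mu := c + a * lam / 2) in *.
  assert (Hmu : 0 < mu) by (unfold mu; nra).
  pose proof (wsq_young 0 L T HL HT lam mu w F Hmu ltac:(ct) ltac:(ct)) as HY.
  pose proof (exp_pos (- lam * L)) as He.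
  replace (c + a * lam / 2 - 0 * lam ^ 2 / 2) with mu in HE by (unfold mu; field).
  assert (HB' : 0 <= exp (- lam * L) * (a / 2 * RInt (fun t => w L t ^ 2) 0 T))
    by (apply Rmult_le_pos; [lra | apply Rmult_le_pos; [lra | exact HB]]).
  set (W := wsq 0 L T lam w) in *. set (S := wsq 0 L T lam F) in *.
  set (B := RInt (fun t => w 0 t ^ 2) 0 T) in *.
  assert (H : mu / 2 * W <= a / 2 * B + / (2 * mu) * S) by lra.
  apply Rmult_le_reg_l with (mu / 2); [lra|].
  replace (mu / 2 * (a / mu * B + / mu ^ 2 * S)) with (a / 2 * B + / (2 * mu) * S)
    by (field; lra). exact H.
Qed.

(** Transport now goes to the left, so the decaying weight costs damping: it takes half of the
    zeroth-order coefficient [a ^ 2 / nu]. The remaining half is spent on absorbing the source, and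
    the outflow trace at 0 is what is kept. The constant is [1 / (a * mu)] with
    [mu = a ^ 2 / nu]. *)
Lemma modified_advection_estimate (nu a c L T : R) (w F : R -> R -> R) :
  0 < nu -> 0 < a -> 0 < c -> 0 < L -> 0 < T ->
  smooth2 w -> smooth2 F -> eqR 0 L T (Lgen 0 (- a) (c + a ^ 2 / nu) w) F ->
  (forall t, 0 <= t <= T -> w L t = 0) -> (forall x, 0 <= x <= L -> w x 0 = 0) ->
  RInt (fun t => w 0 t ^ 2) 0 T <= nu / a ^ 3 * wsq 0 L T (a / nu) F.
Proof.
  intros Hnu Ha Hc HL HT Hw HF Heq HwL H0.
  pose proof (energy_zero_initial 0 L T HL HT 0 (- a) _ (a / nu) w F Hw Heq H0) as HE.
  rewrite !flux_advection, Rmult_0_r, exp_0 in HE by auto.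
  rewrite (RInt_ext_open (fun t => w L t ^ 2) (fun _ => 0)) in HE.
  2: lra. 2:{ intros t Ht. rewrite HwL by lra. ring. }
  rewrite RInt_zero in HE.
  set (mu := a ^ 2 / nu).
  assert (Hmu : 0 < mu) by (apply Rdiv_lt_0_compat; nra).
  pose proof (wsq_young 0 L T HL HT (a / nu) mu w F Hmu ltac:(ct) ltac:(ct)) as HY.
  pose proof (wsq_nonneg 0 L T HL HT (a / nu) w ltac:(ct)) as HW.
  replace (c + a ^ 2 / nu + - a * (a / nu) / 2 - 0 * (a / nu) ^ 2 / 2) with (c + mu / 2) in HE
    by (unfold mu; field; lra).
  set (W := wsq 0 L T (a / nu) w) in *. set (S := wsq 0 L T (a / nu) F) in *.
  set (B := RInt (fun t => w 0 t ^ 2) 0 T) in *.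
  assert (H : a / 2 * B <= / (2 * mu) * S) by nra.
  apply Rmult_le_reg_l with (a / 2); [lra|].
  replace (a / 2 * (nu / a ^ 3 * S)) with (/ (2 * mu) * S) by (unfold mu; field; lra).
  exact H.
Qed.

Lemma RInt_mult_dt (T : R) (w : R -> R -> R) (x : R) : 0 < T -> smooth2 w ->
  RInt (fun t => w x t * dt w x t) 0 T = / 2 * (w x T ^ 2 - w x 0 ^ 2).
Proof.
  intros HT Hw.
  assert (H : forall t, is_derive (fun t => / 2 * w x t ^ 2) t (w x t * dt w x t)).
  { intros t. auto_derive; [now apply (smooth2_ex_derive_t w)|].
    change (Derive (fun s => w x s) t) with (dt w x t). field. }
  transitivity (RInt (Derive (fun t => / 2 * w x t ^ 2)) 0 T).
  { apply RInt_ext_open; [lra|]. intros t _. symmetry. apply is_derive_unique, H. }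
  rewrite RInt_Derive; [match goal with |- ?p = ?q => change (@eq R p q) end; field| |].
  - intros t _. eexists. apply H.
  - intros t _. apply (continuous_ext (fun t => w x t * dt w x t)).
    + intros s. symmetry. apply is_derive_unique, H.
    + revert t. change (Cont1 (fun t => w x t * dt w x t)). ct.
Qed.

(* Integrating [w * La w] in time turns the transmission condition into a bound on
   the diffusive flux through the interface. *)
Lemma interface_flux (a c T : R) (w : R -> R -> R) (m : R -> R) :
  0 < a -> 0 < c -> 0 < T -> smooth2 w -> smooth1 m ->
  (forall t, 0 <= t <= T -> Lgen 0 a c w 0 t = m t) -> w 0 0 = 0 ->
  a * RInt (fun t => w 0 t * dx w 0 t) 0 T <= RInt (fun t => w 0 t * m t) 0 T.
Proof.
  intros Ha Hc HT Hw Hm Hi H0.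
  rewrite <- RInt_scal_Cont1 by ct.
  assert (E : RInt (fun t => w 0 t * m t) 0 T
    = RInt (fun t => w 0 t * dt w 0 t) 0 T + (RInt (fun t => a * (w 0 t * dx w 0 t)) 0 T
      + c * RInt (fun t => w 0 t ^ 2) 0 T)).
  { rewrite <- (RInt_scal_Cont1 c), <- !RInt_plus_Cont1 by ct.
    apply RInt_ext_open; [lra|]. intros t Ht. rewrite <- Hi by lra. unfold Lgen. ring. }
  rewrite E, RInt_mult_dt, H0 by auto.
  pose proof (RInt_sqr_nonneg 0 T (fun t => w 0 t) (Rlt_le _ _ HT) ltac:(ct)).
  pose proof (pow2_ge_0 (w 0 T)). nra.
Qed.

(** Integrating the [x] derivative of [exp (- lam * x) * w ^ 2] from the end where [w] vanishes
    leaves a trace at 0 of the right sign; Young's inequality does the rest. With [lam = a / nu] the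
    constant is of order [nu ^ 2], a gain that the zeroth-order term [c] of the energy cannot
    give. *)
Lemma weighted_hardy (l T lam : R) (w : R -> R -> R) :
  l < 0 -> 0 < T -> 0 < lam -> smooth2 w ->
  (forall t, 0 <= t <= T -> w l t = 0) ->
  wsq l 0 T lam w <= 4 / lam ^ 2 * wsq l 0 T lam (dx w).
Proof.
  intros Hl HT Hlam Hw H0.
  assert (E : I2 l 0 T (fun x t => 2 * (exp (- lam * x) * (w x t * dx w x t))
      + (- lam) * (exp (- lam * x) * w x t ^ 2))
    = RInt (fun t => exp (- lam * 0) * w 0 t ^ 2 - exp (- lam * l) * w l t ^ 2) 0 T).
  { apply (I2_derive_x l 0 T (fun x t => exp (- lam * x) * w x t ^ 2)); [ct|].
    intros x t. auto_derive; [now apply (smooth2_ex_derive_x w)|].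
    change (Derive (fun y => w y t) x) with (dx w x t). ring. }
  rewrite I2_plus, !I2_scal in E by ct.
  rewrite (RInt_ext_open _ (fun t => w 0 t ^ 2)) in E.
  2: lra.
  2:{ intros t Ht. rewrite H0, Rmult_0_r, exp_0 by lra. ring. }
  pose proof (RInt_sqr_nonneg 0 T (fun t => w 0 t) (Rlt_le _ _ HT) ltac:(ct)) as HB.
  pose proof (wsq_young l 0 T Hl HT lam (lam / 2) w (dx w) ltac:(lra) ltac:(ct) ltac:(ct)) as HY.
  change (I2 l 0 T (fun x t => exp (- lam * x) * w x t ^ 2)) with (wsq l 0 T lam w) in E.
  set (W := wsq l 0 T lam w) in *. set (D := wsq l 0 T lam (dx w)) in *.
  assert (H : lam / 2 * W <= / (2 * (lam / 2)) * (2 * D)) by lra.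
  apply Rmult_le_reg_l with (lam / 2); [lra|].
  replace (lam / 2 * (4 / lam ^ 2 * D)) with (/ (2 * (lam / 2)) * (2 * D)) by (field; lra).
  exact H.
Qed.

(** Two energies with the same diffusive flux [nu * X] at the interface are combined. The unweighted
    one bounds the trace, [a / 2 * B <= nu * X]; the one with weight [a / nu], whose flux contains
    no [w ^ 2], bounds the weighted gradient, [nu * D1 <= nu * X]. The transmission condition bounds
    [a * X] by the pairing of the trace with [m], and the Hardy inequality converts the gradient
    bound into one on [w]. *)
Lemma boundary_layer_estimate (nu a c l T : R) (w : R -> R -> R) (m : R -> R) :
  0 < nu -> 0 < a -> 0 < c -> l < 0 -> 0 < T -> smooth2 w -> smooth1 m ->
  eqR l 0 T (Lgen nu a c w) (fun _ _ => 0) ->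
  (forall t, 0 <= t <= T -> w l t = 0) ->
  (forall t, 0 <= t <= T -> Lgen 0 a c w 0 t = m t) ->
  (forall x, l <= x <= 0 -> w x 0 = 0) ->
  RInt (fun t => w 0 t ^ 2) 0 T <= 4 * nu ^ 2 / a ^ 4 * RInt (fun t => m t ^ 2) 0 T /\
  sqL2_2 l 0 T w <= 8 * nu ^ 3 / a ^ 5 * RInt (fun t => m t ^ 2) 0 T.
Proof.
  intros Hnu Ha Hc Hl HT Hw Hm Heq Hwl Hwr H0.
  pose proof (interface_flux a c T w m Ha Hc HT Hw Hm Hwr (H0 0 ltac:(lra))) as HI.
  assert (Hfl : forall lam, flux T nu a lam w l = 0).
  { intros lam. unfold flux. rewrite (RInt_ext_open _ (fun _ => 0)).
    - rewrite RInt_zero. ring.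
    - lra.
    - intros t Ht. rewrite Hwl by lra. ring. }
  assert (Hf0 : forall lam, flux T nu a lam w 0
    = (a - nu * lam) / 2 * RInt (fun t => w 0 t ^ 2) 0 T
      - nu * RInt (fun t => w 0 t * dx w 0 t) 0 T).
  { intros lam. unfold flux. rewrite Rmult_0_r, exp_0, Rmult_1_l.
    rewrite RInt_minus_Cont1, !RInt_scal_Cont1 by ct. reflexivity. }
  assert (Hz : forall lam, I2 l 0 T (fun x t => exp (- lam * x) * (w x t * 0)) = 0).
  { intros lam. rewrite (I2_ext l 0 T Hl HT _ (fun x t => 0 * (exp (- lam * x) * w x t)))
      by (intros; ring). rewrite I2_scal by ct. ring. }
  pose proof (energy_zero_initial l 0 T Hl HT nu a c 0 w _ Hw Heq H0) as HE0.
  pose proof (energy_zero_initial l 0 T Hl HT nu a c (a / nu) w _ Hw Heq H0) as HE1.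
  rewrite Hfl, Hf0, Hz in HE0, HE1.
  (* With this parameter, multiplication by [nu / a] leaves [a / 4 * B], half of what the unweighted
     energy controls. *)
  pose proof (RInt_young (a ^ 2 / (2 * nu)) 0 T (fun t => w 0 t) m
    ltac:(apply Rdiv_lt_0_compat; nra) (Rlt_le _ _ HT) ltac:(ct) ltac:(now apply Cont1_smooth)) as HY.
  pose proof (wsq_nonneg l 0 T Hl HT 0 w ltac:(ct)) as HW0.
  pose proof (wsq_nonneg l 0 T Hl HT 0 (dx w) ltac:(ct)) as HD0.
  pose proof (wsq_nonneg l 0 T Hl HT (a / nu) w ltac:(ct)) as HW1.
  pose proof (wsq_nonneg l 0 T Hl HT (a / nu) (dx w) ltac:(ct)) as HD1.
  pose proof (weighted_hardy l T (a / nu) w Hl HT ltac:(now apply Rdiv_lt_0_compat) Hw Hwl) as HH.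
  (* The weight is at least 1 because [x <= 0]. *)
  assert (HM : sqL2_2 l 0 T w <= wsq l 0 T (a / nu) w).
  { rewrite <- (wsq_0 l 0 T Hl HT). apply I2_le; ct. intros x t Hx Ht.
    apply Rmult_le_compat_r; [apply pow2_ge_0|].
    rewrite Ropp_0, Rmult_0_l, exp_0. rewrite <- exp_0.
    destruct (Rle_lt_or_eq_dec 0 (- (a / nu) * x)) as [Hlt|He].
    - assert (0 < a / nu) by now apply Rdiv_lt_0_compat. nra.
    - left. now apply exp_increasing.
    - rewrite <- He. lra. }
  set (B := RInt (fun t => w 0 t ^ 2) 0 T) in *.
  set (X := RInt (fun t => w 0 t * dx w 0 t) 0 T) in *.
  set (Y := RInt (fun t => w 0 t * m t) 0 T) in *.
  set (M := RInt (fun t => m t ^ 2) 0 T) in *.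
  set (D1 := wsq l 0 T (a / nu) (dx w)) in *.
  set (W1 := wsq l 0 T (a / nu) w) in *.
  replace (c + a * (a / nu) / 2 - nu * (a / nu) ^ 2 / 2) with c in HE1 by (field; lra).
  replace ((a - nu * (a / nu)) / 2) with 0 in HE1 by (field; lra).
  assert (HB : a / 2 * B <= nu * X) by nra.
  assert (HX : nu * X <= a / 4 * B + nu ^ 2 / a ^ 3 * M).
  { replace (nu * X) with (nu / a * (a * X)) by (field; lra).
    replace (a / 4 * B + nu ^ 2 / a ^ 3 * M)
      with (nu / a * (a ^ 2 / (2 * nu) / 2 * B + / (2 * (a ^ 2 / (2 * nu))) * M))
      by (field; lra).
    apply Rmult_le_compat_l; [left; now apply Rdiv_lt_0_compat | lra]. }
  assert (HB' : B <= 4 * nu ^ 2 / a ^ 4 * M).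
  { apply Rmult_le_reg_l with (a / 4); [lra|].
    replace (a / 4 * (4 * nu ^ 2 / a ^ 4 * M)) with (nu ^ 2 / a ^ 3 * M) by (field; lra).
    lra. }
  split; [exact HB'|].
  assert (HD : nu * D1 <= 2 * (nu ^ 2 / a ^ 3 * M)).
  { assert (a / 4 * B <= nu ^ 2 / a ^ 3 * M) by lra. nra. }
  apply Rle_trans with (1 := HM), Rle_trans with (1 := HH).
  replace (4 / (a / nu) ^ 2 * D1) with (4 * nu / a ^ 2 * (nu * D1)) by (field; lra).
  replace (8 * nu ^ 3 / a ^ 5 * M) with (4 * nu / a ^ 2 * (2 * (nu ^ 2 / a ^ 3 * M)))
    by (field; lra).
  apply Rmult_le_compat_l; [|exact HD].
  left. apply Rdiv_lt_0_compat; nra.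
Qed.

(* The Robin condition at the inflow end prescribes the total flux, which makes the
   estimate uniform in [nu]. *)
Lemma inflow_estimate (nu a c l r T : R) (w F : R -> R -> R) (q : R -> R) :
  0 < nu -> 0 < a -> 0 < c -> l < r -> 0 < T -> smooth2 w -> smooth2 F -> smooth1 q ->
  eqR l r T (Lgen nu a c w) F ->
  (forall t, 0 <= t <= T -> nu * dx w l t = a * w l t + q t) ->
  (forall t, 0 <= t <= T -> w r t * dx w r t = 0) ->
  nu * sqL2_2 l r T (dx w) + c / 2 * sqL2_2 l r T w
    + a / 4 * RInt (fun t => w l t ^ 2) 0 T
  <= / (2 * c) * sqL2_2 l r T F + / a * RInt (fun t => q t ^ 2) 0 T
    + / 2 * RInt (fun x => w x 0 ^ 2) l r.
Proof.
  intros Hnu Ha Hc Hlr HT Hw HF Hq Heq Hl Hr.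
  pose proof (energy_identity l r T Hlr HT nu a c 0 w Hw) as HE.
  rewrite (I2_ext l r T Hlr HT _ (fun x t => exp (- 0 * x) * (w x t * F x t))) in HE.
  2:{ intros x t Hx Ht. rewrite <- Heq by lra. reflexivity. }
  pose proof (wsq_young l r T Hlr HT 0 c w F Hc ltac:(ct) ltac:(ct)) as HY.
  rewrite !wsq_0 in HE, HY by auto.
  assert (He : forall s, RInt (fun x => exp (- 0 * x) * w x s ^ 2) l r
    = RInt (fun x => w x s ^ 2) l r).
  { intros s. apply RInt_ext_open; [lra|]. intros x _.
    rewrite Ropp_0, Rmult_0_l, exp_0. ring. }
  rewrite !He in HE.
  (* Only the product of [w] and its derivative has to vanish at [r]. This covers both later uses:
     for [u_x] the derivative vanishes there, for [u_xx] the function itself. *)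
  assert (Hfr : 0 <= flux T nu a 0 w r).
  { unfold flux. rewrite Ropp_0, Rmult_0_l, exp_0, Rmult_1_l.
    apply RInt_nonneg; [lra | ct |]. intros t Ht. rewrite Hr by lra.
    pose proof (pow2_ge_0 (w r t)). nra. }
  assert (Hfl : flux T nu a 0 w l <= / a * RInt (fun t => q t ^ 2) 0 T
    + - (a / 4) * RInt (fun t => w l t ^ 2) 0 T).
  { unfold flux. rewrite Ropp_0, Rmult_0_l, exp_0, Rmult_1_l.
    rewrite <- !RInt_scal_Cont1, <- RInt_plus_Cont1 by (ct; now apply Cont1_smooth).
    apply RInt_le_Cont1; [lra | ct | ct; now apply Cont1_smooth |].
    intros t Ht.
    replace (nu * (w l t * dx w l t)) with (w l t * (a * w l t + q t))
      by (rewrite <- Hl by lra; ring).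
    (* By the Robin condition the flux density at [l] is [- a / 2 * w ^ 2 - w * q]. This square
       bounds it by [q ^ 2 / a] and still leaves [- a / 4 * w ^ 2] for the trace. *)
    assert (0 <= / a * (a / 2 * w l t + q t) ^ 2).
    { apply Rmult_le_pos; [left; now apply Rinv_0_lt_compat | apply pow2_ge_0]. }
    replace (/ a * (a / 2 * w l t + q t) ^ 2)
      with (a / 4 * w l t ^ 2 + w l t * q t + / a * q t ^ 2) in H by (field; lra).
    lra. }
  pose proof (RInt_sqr_nonneg l r (fun x => w x T) (Rlt_le _ _ Hlr) ltac:(ct)).
  replace (c + a * 0 / 2 - nu * 0 ^ 2 / 2) with c in HE by field.
  lra.
Qed.

(** * Sobolev bounds of the data *)

(** The support condition on [f] speaks only of [t <= T], so at [t = T] only a left neighbourhood is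
    known. Since the derivative exists, left difference quotients determine it. *)
Lemma Derive_zero_left (g : R -> R) (t d : R) : 0 < d -> ex_derive g t ->
  (forall s, t - d < s <= t -> g s = 0) -> Derive g t = 0.
Proof.
  intros Hd Hg H.
  destruct (Req_dec (Derive g t) 0) as [|Hn]; [assumption|exfalso].
  apply Derive_correct, is_derive_Reals in Hg.
  destruct (Hg (Rabs (Derive g t)) (Rabs_pos_lt _ Hn)) as [e He].
  pose proof (cond_pos e). pose proof (Rmin_l e d). pose proof (Rmin_r e d).
  pose proof (Rmin_pos e d ltac:(lra) ltac:(lra)).
  specialize (He (- (Rmin e d / 2)) ltac:(lra)).
  rewrite Rabs_Ropp, Rabs_pos_eq in He by lra.
  specialize (He ltac:(lra)).
  rewrite !H in He by lra.
  replace ((0 - 0) / - (Rmin e d / 2) - Derive g t) with (- Derive g t) in He by (field; lra).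
  rewrite Rabs_Ropp in He. lra.
Qed.

Lemma C0inf_cyl_dt_plus (c l r T : R) (f : R -> R -> R) :
  C0inf_cyl l r T f -> C0inf_cyl l r T (dt_plus c f).
Proof.
  intros [Hf (al & be & de & Hal & Hbe & Hde & H)].
  split; [sm|]. exists al, be, de. repeat split; auto.
  intros x t Ht Hx. unfold dt_plus. rewrite H by auto.
  unfold dt. rewrite (Derive_zero_left _ t 1); [ring | lra | now apply smooth2_ex_derive_t|].
  intros s Hs. apply H; [lra|]. destruct Hx as [Hx|[Hx|Hx]]; auto. right; right; lra.
Qed.

Lemma C0inf_cyl_left (l r T : R) (f : R -> R -> R) : C0inf_cyl l r T f ->
  forall t, t <= T -> f l t = 0 /\ dx f l t = 0.
Proof.
  intros [Hf (al & be & de & Hal & Hbe & Hde & H)] t Ht. split; [now apply H; auto|].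
  unfold dx. rewrite <- (Derive_const 0 l). apply Derive_ext_loc.
  apply (locally_open_interval (l - 1) al); [lra|]. intros y Hy. apply H; lra.
Qed.

Lemma C0inf_cyl_right (l r T : R) (f : R -> R -> R) : C0inf_cyl l r T f ->
  forall t, t <= T -> f r t = 0.
Proof.
  intros [Hf (al & be & de & Hal & Hbe & Hde & H)] t Ht. apply H; auto.
Qed.

Lemma C0inf_cyl_initial (l r T : R) (f : R -> R -> R) : 0 < T -> C0inf_cyl l r T f ->
  forall x, f x 0 = 0.
Proof.
  intros HT [Hf (al & be & de & Hal & Hbe & Hde & H)] x. apply H; [lra|auto].
Qed.

Lemma smooth1_const (k : R) : smooth1 (fun _ => k).
Proof.
  intros n s. destruct n as [|n]; [exact I|]. simpl.
  apply (ex_derive_ext (fun s => match n with 0%nat => k | S _ => 0 end)).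
  - intros t. destruct n as [|n]; [reflexivity|]. now rewrite Derive_n_const.
  - apply @ex_derive_const.
Qed.

Lemma D_plus_0 (c t : R) : D_plus c (fun _ => 0) t = 0.
Proof. unfold D_plus. rewrite Derive_const. ring. Qed.

Lemma smooth2_0 : smooth2 (fun _ _ => 0).
Proof.
  intros n. induction n as [|n IH]; intros x t; simpl.
  - split; [apply continuity_2d_pt_const | exact I].
  - repeat split.
    + apply continuity_2d_pt_const.
    + apply @ex_derive_const.
    + apply @ex_derive_const.
    + replace (fun u v : R => Derive (fun _ : R => 0) u) with (fun _ _ : R => 0); [apply IH|].
      apply functional_extensionality; intros y. apply functional_extensionality; intros s.
      now rewrite Derive_const.
    + replace (fun u v : R => Derive (fun _ : R => 0) v) with (fun _ _ : R => 0); [apply IH|].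
      apply functional_extensionality; intros y. apply functional_extensionality; intros s.
      now rewrite Derive_const.
Qed.

Lemma partial_derive_iter (i p : nat) (u : R -> R -> R) :
  partial_derive i p u = Nat.iter i dx (Nat.iter p dt u).
Proof.
  assert (Ht : forall x t, Derive_n (fun z => u x z) p t = Nat.iter p dt u x t).
  { induction p as [|p IH]; intros x t; [reflexivity|]. simpl. unfold dt at 1.
    apply Derive_ext. intros s. apply IH. }
  apply functional_extensionality; intros x. apply functional_extensionality; intros t.
  unfold partial_derive. revert x. induction i as [|i IH]; intros x; simpl; [apply Ht|].
  unfold dx at 1. apply Derive_ext. intros y. apply IH.
Qed.

Lemma partial_derive_dt (i p : nat) (u : R -> R -> R) :
  partial_derive i p (dt u) = partial_derive i (S p) u.
Proof. now rewrite !partial_derive_iter, <- Nat.iter_succ_r. Qed.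

Lemma smooth2_iter_dt (p : nat) (u : R -> R -> R) : smooth2 u -> smooth2 (Nat.iter p dt u).
Proof. intros H. induction p; simpl; sm. Qed.

Lemma smooth2_iter_dx (p : nat) (u : R -> R -> R) : smooth2 u -> smooth2 (Nat.iter p dx u).
Proof. intros H. induction p; simpl; sm. Qed.

Lemma smooth2_partial_derive (i p : nat) (u : R -> R -> R) :
  smooth2 u -> smooth2 (partial_derive i p u).
Proof.
  intros H. rewrite partial_derive_iter. now apply smooth2_iter_dx, smooth2_iter_dt.
Qed.

Lemma partial_derive_comb (i p : nat) (k m : R) (u v : R -> R -> R) :
  smooth2 u -> smooth2 v ->
  partial_derive i p (fun x t => k * u x t + m * v x t)
  = fun x t => k * partial_derive i p u x t + m * partial_derive i p v x t.
Proof.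
  intros Hu Hv. rewrite !partial_derive_iter.
  assert (Ht : Nat.iter p dt (fun x t => k * u x t + m * v x t)
    = fun x t => k * Nat.iter p dt u x t + m * Nat.iter p dt v x t).
  { induction p as [|p IH]; [reflexivity|]. simpl. rewrite IH.
    apply dt_comb; now apply smooth2_iter_dt. }
  rewrite Ht. induction i as [|i IH]; [reflexivity|]. simpl. rewrite IH.
  apply dx_comb; now apply smooth2_iter_dx, smooth2_iter_dt.
Qed.

(** A common bound for each derivative rather than for their sum: applying [d_t + c] then shifts the
    order and multiplies [M] by a constant, with no bookkeeping of sums. *)
Definition bound2 (k : nat) (l r T M : R) (f : R -> R -> R) : Prop :=
  forall i p, (i + p <= k)%nat -> sqL2_2 l r T (partial_derive i p f) <= M.

Definition bound1 (k : nat) (l r M : R) (g : R -> R) : Prop :=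
  forall p, (p <= k)%nat -> sqL2_1 l r (Derive_n g p) <= M.

Lemma sqL2_2_nonneg (l r T : R) (u : R -> R -> R) : l < r -> 0 < T -> Cont2 u ->
  0 <= sqL2_2 l r T u.
Proof. intros Hlr HT Hu. rewrite <- (wsq_0 l r T Hlr HT). now apply wsq_nonneg. Qed.

Lemma sqL2_2_comb (l r T p q : R) (u v : R -> R -> R) : l < r -> 0 < T ->
  Cont2 u -> Cont2 v ->
  sqL2_2 l r T (fun x t => p * u x t + q * v x t)
  <= 2 * p ^ 2 * sqL2_2 l r T u + 2 * q ^ 2 * sqL2_2 l r T v.
Proof. intros Hlr HT Hu Hv. rewrite <- !(wsq_0 l r T Hlr HT). now apply wsq_comb. Qed.

Lemma sqL2_1_comb (l r p q : R) (g h : R -> R) : l <= r -> Cont1 g -> Cont1 h ->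
  sqL2_1 l r (fun s => p * g s + q * h s)
  <= 2 * p ^ 2 * sqL2_1 l r g + 2 * q ^ 2 * sqL2_1 l r h.
Proof.
  intros Hlr Hg Hh. unfold sqL2_1.
  rewrite <- !RInt_scal_Cont1, <- RInt_plus_Cont1 by ct.
  apply RInt_le_Cont1; ct. intros s _. pose proof (pow2_ge_0 (p * g s - q * h s)). nra.
Qed.

Lemma smooth1_Derive_n (n : nat) (g : R -> R) : smooth1 g -> smooth1 (Derive_n g n).
Proof. intros H. induction n as [|n IH]; [exact H|]. now apply (smooth1_Derive (Derive_n g n)). Qed.

Lemma bound2_le (k k' : nat) (l r T M M' : R) (f : R -> R -> R) : (k' <= k)%nat -> M <= M' ->
  bound2 k l r T M f -> bound2 k' l r T M' f.
Proof. intros Hk HM H i p Hip. apply Rle_trans with M; [apply H; lia | exact HM]. Qed.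

Lemma bound1_le (k k' : nat) (l r M M' : R) (g : R -> R) : (k' <= k)%nat -> M <= M' ->
  bound1 k l r M g -> bound1 k' l r M' g.
Proof. intros Hk HM H p Hp. apply Rle_trans with M; [apply H; lia | exact HM]. Qed.

Lemma bound2_dt_plus (k : nat) (c l r T M : R) (f : R -> R -> R) : l < r -> 0 < T ->
  smooth2 f -> bound2 (S k) l r T M f -> bound2 k l r T ((2 + 2 * c ^ 2) * M) (dt_plus c f).
Proof.
  intros Hlr HT Hf H i p Hip.
  rewrite dt_plusE, partial_derive_comb, partial_derive_dt by sm.
  pose proof (sqL2_2_comb l r T 1 c (partial_derive i (S p) f) (partial_derive i p f) Hlr HT
    ltac:(now apply Cont2_smooth, smooth2_partial_derive)
    ltac:(now apply Cont2_smooth, smooth2_partial_derive)) as Hc.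
  pose proof (H i (S p) ltac:(lia)). pose proof (H i p ltac:(lia)).
  pose proof (pow2_ge_0 c). nra.
Qed.

Lemma bound1_D_plus (k : nat) (c l r M : R) (g : R -> R) : l < r ->
  smooth1 g -> bound1 (S k) l r M g -> bound1 k l r ((2 + 2 * c ^ 2) * M) (D_plus c g).
Proof.
  intros Hlr Hg H p Hp.
  rewrite D_plusE, Derive_n_comb by auto using smooth1_Derive.
  pose proof (sqL2_1_comb l r 1 c (Derive_n (Derive g) p) (Derive_n g p) (Rlt_le _ _ Hlr)
    ltac:(now apply Cont1_smooth, smooth1_Derive_n, smooth1_Derive)
    ltac:(now apply Cont1_smooth, smooth1_Derive_n)) as Hc.
  assert (E : Derive_n (Derive g) p = Derive_n g (S p)).
  { apply functional_extensionality. intros s. apply Derive_n_Derive. }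
  rewrite E in Hc |- *.
  pose proof (H (S p) ltac:(lia)). pose proof (H p ltac:(lia)).
  pose proof (pow2_ge_0 c). nra.
Qed.

Lemma bound1_ext (k : nat) (l r M : R) (g h : R -> R) : l < r ->
  (forall s, l < s < r -> g s = h s) -> bound1 k l r M h -> bound1 k l r M g.
Proof.
  intros Hlr E H p Hp. apply Rle_trans with (2 := H p Hp). right.
  apply RInt_ext_open; [lra|]. intros s Hs. f_equal. apply Derive_n_ext_loc.
  now apply (locally_open_interval l r).
Qed.

(** The function bounded here is the initial value of [(d_t + c) u], read off the equation at
    [t = 0] where [f] vanishes. The bound [nu <= 1] keeps the constant free of [nu]. *)
Lemma bound1_generator (k : nat) (nu a l r M : R) (g : R -> R) : l < r -> 0 < nu <= 1 ->
  0 <= M -> smooth1 g -> bound1 (S (S k)) l r M g ->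
  bound1 k l r ((2 + 2 * a ^ 2) * M) (fun s => nu * Derive_n g 2 s + - a * Derive g s).
Proof.
  intros Hlr Hnu HM Hg H p Hp.
  rewrite Derive_n_comb by auto using smooth1_Derive, smooth1_Derive_n.
  assert (E : Derive_n (Derive g) p = Derive_n g (S p)).
  { apply functional_extensionality. intros s. apply Derive_n_Derive. }
  assert (E2 : Derive_n (Derive_n g 2) p = Derive_n g (S (S p))).
  { apply functional_extensionality. intros s. rewrite Derive_n_comp. f_equal. lia. }
  rewrite E, E2.
  pose proof (sqL2_1_comb l r nu (- a) (Derive_n g (S (S p))) (Derive_n g (S p)) (Rlt_le _ _ Hlr)
    ltac:(now apply Cont1_smooth, smooth1_Derive_n)
    ltac:(now apply Cont1_smooth, smooth1_Derive_n)) as Hc.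
  pose proof (H (S (S p)) ltac:(lia)). pose proof (H (S p) ltac:(lia)).
  pose proof (RInt_sqr_nonneg l r (Derive_n g (S (S p))) (Rlt_le _ _ Hlr)
    ltac:(now apply Cont1_smooth, smooth1_Derive_n)) as Hnn.
  change (0 <= sqL2_1 l r (Derive_n g (S (S p)))) in Hnn.
  pose proof (pow2_ge_0 a). replace ((- a) ^ 2) with (a ^ 2) in Hc by ring.
  assert (nu ^ 2 <= 1) by nra.
  assert (nu ^ 2 * sqL2_1 l r (Derive_n g (S (S p))) <= 1 * M)
    by (apply Rmult_le_compat; nra).
  nra.
Qed.

(** * The viscous solution *)

(** The viscous problem in a form stable under [d_t + c]: all identities hold up to the boundary,
    and no initial value is prescribed, since [d_t + c] would change it. Its size is recorded
    separately in [bounded_data], through the trace of [u]. *)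
Record viscous (nu a c l r T : R) (f : R -> R -> R) (g : R -> R) (u : R -> R -> R) : Prop := {
  viscous_smooth : smooth2 u;
  viscous_source : C0inf_cyl l r T f;
  viscous_inflow_smooth : smooth1 g;
  viscous_eq : eqR l r T (Lgen nu a c u) f;
  viscous_inflow : forall t, 0 <= t <= T -> u l t = g t;
  viscous_outflow : forall t, 0 <= t <= T -> Lgen 0 a c u r t = 0 }.

(* The initial trace is measured with [m] derivatives; one time derivative of the
   solution costs one derivative of [f], [g] and two of the initial trace. *)
Record bounded_data (k m : nat) (l r T M : R) (f : R -> R -> R) (g : R -> R)
    (u : R -> R -> R) : Prop := {
  bounded_source : bound2 k l r T M f;
  bounded_inflow : bound1 k 0 T M g;
  bounded_initial : bound1 m l r M (fun x => u x 0) }.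

Lemma bounded_data_le (k k' m m' : nat) (l r T M M' : R) (f : R -> R -> R) (g : R -> R)
    (u : R -> R -> R) : (k' <= k)%nat -> (m' <= m)%nat -> M <= M' ->
  bounded_data k m l r T M f g u -> bounded_data k' m' l r T M' f g u.
Proof.
  intros Hk Hm HM [H1 H2 H3]. split;
    [now apply (bound2_le k k' l r T M) | now apply (bound1_le k k' 0 T M)
    | now apply (bound1_le m m' l r M)].
Qed.

Lemma viscous_dt_plus (nu a c l r T : R) f g u : l < r -> 0 < T ->
  viscous nu a c l r T f g u ->
  viscous nu a c l r T (dt_plus c f) (D_plus c g) (dt_plus c u).
Proof.
  intros Hlr HT [Hu Hf Hg He Hi Ho]. split.
  - sm.
  - now apply C0inf_cyl_dt_plus.
  - now apply smooth1_D_plus.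
  - rewrite <- Lgen_dt_plus by auto. apply eqR_dt_plus; [auto | sm | apply Hf | exact He].
  - intros t Ht. apply (eqI_D_plus c 0 T (fun t => u l t) g); auto using smooth1_trace_t.
  - intros t Ht. rewrite <- Lgen_dt_plus by auto. transitivity (D_plus c (fun _ => 0) t); [|apply D_plus_0].
    apply (eqI_D_plus c 0 T (fun t => Lgen 0 a c u r t) (fun _ => 0)); auto using smooth1_const.
    apply smooth1_trace_t. sm.
Qed.

Lemma bounded_data_dt_plus (k m : nat) (nu a c l r T M : R) f g u :
  l < r -> 0 < T -> 0 < nu <= 1 -> 0 <= M -> viscous nu a c l r T f g u ->
  bounded_data (S k) (S (S m)) l r T M f g u ->
  bounded_data k m l r T ((2 + 2 * c ^ 2 + 2 * a ^ 2) * M)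
    (dt_plus c f) (D_plus c g) (dt_plus c u).
Proof.
  intros Hlr HT Hnu HM [Hu Hf Hg He Hi Ho] [Bf Bg Bu].
  pose proof (pow2_ge_0 a). pose proof (pow2_ge_0 c). split.
  - apply (bound2_le k k l r T ((2 + 2 * c ^ 2) * M)); [lia | nra |].
    apply bound2_dt_plus; auto. apply Hf.
  - apply (bound1_le k k 0 T ((2 + 2 * c ^ 2) * M)); [lia | nra |].
    now apply bound1_D_plus.
  - apply (bound1_le m m l r ((2 + 2 * a ^ 2) * M)); [lia | nra |].
    apply (bound1_ext m l r _ _ (fun s => nu * Derive_n (fun x => u x 0) 2 s
      + - a * Derive (fun x => u x 0) s)); [auto | |].
    + intros x Hx. specialize (He x 0 ltac:(lra) ltac:(lra)).
      rewrite (C0inf_cyl_initial l r T f HT Hf) in He.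
      unfold dt_plus. unfold Lgen, dxx, dx in He. lra.
    + apply bound1_generator; auto. now apply smooth1_trace_x.
Qed.

Lemma viscous_iter (j k m : nat) (nu a c l r T M : R) f g u :
  l < r -> 0 < T -> 0 < nu <= 1 -> 0 <= M -> viscous nu a c l r T f g u ->
  bounded_data (j + k) (2 * j + m) l r T M f g u ->
  viscous nu a c l r T (Nat.iter j (dt_plus c) f) (Nat.iter j (D_plus c) g)
    (Nat.iter j (dt_plus c) u) /\
  bounded_data k m l r T ((2 + 2 * c ^ 2 + 2 * a ^ 2) ^ j * M)
    (Nat.iter j (dt_plus c) f) (Nat.iter j (D_plus c) g) (Nat.iter j (dt_plus c) u).
Proof.
  intros Hlr HT Hnu. revert k m M f g u. induction j as [|j IH]; intros k m M f g u HM Hv Hb.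
  - simpl. rewrite Rmult_1_l. auto.
  - pose proof (pow2_ge_0 a). pose proof (pow2_ge_0 c).
    rewrite !Nat.iter_succ_r.
    replace ((2 + 2 * c ^ 2 + 2 * a ^ 2) ^ S j * M)
      with ((2 + 2 * c ^ 2 + 2 * a ^ 2) ^ j * ((2 + 2 * c ^ 2 + 2 * a ^ 2) * M)) by (simpl; ring).
    apply IH.
    + nra.
    + now apply viscous_dt_plus.
    + apply (bounded_data_dt_plus _ _ nu); auto.
      replace (S (S (2 * j + m))) with (2 * S j + m)%nat by lia. exact Hb.
Qed.

(** At [r] the source vanishes, so the equation minus the absorbing condition [La u = 0] leaves
    [nu u_xx = 0]. *)
Lemma viscous_outflow_dxx (nu a c l r T : R) f g u : 0 < nu -> l < r -> 0 < T ->
  viscous nu a c l r T f g u -> forall t, 0 <= t <= T -> dxx u r t = 0.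
Proof.
  intros Hnu Hlr HT [Hu Hf Hg He Hi Ho] t Ht.
  specialize (He r t ltac:(lra) Ht). specialize (Ho t Ht).
  rewrite (C0inf_cyl_right l r T f Hf t ltac:(lra)) in He.
  unfold Lgen in He, Ho. nra.
Qed.

(* [u_x] satisfies a Robin condition at the inflow end, where the equation reads
   [nu u_xx = a u_x + g' + c g]. *)
Lemma viscous_dx_estimate (nu a c l r T M : R) f g u :
  0 < a -> 0 < c -> l < r -> 0 < T -> 0 < nu -> viscous nu a c l r T f g u ->
  bounded_data 1 1 l r T M f g u ->
  nu * sqL2_2 l r T (dxx u) + c / 2 * sqL2_2 l r T (dx u)
    + a / 4 * RInt (fun t => dx u l t ^ 2) 0 T
  <= (/ (2 * c) + (2 + 2 * c ^ 2) / a + / 2) * M.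
Proof.
  intros Ha Hc Hlr HT Hnu Hv [Bf Bg Bu].
  pose proof (viscous_outflow_dxx nu a c l r T f g u Hnu Hlr HT Hv) as Hr.
  destruct Hv as [Hu Hf Hg He Hi Ho].
  pose proof (inflow_estimate nu a c l r T (dx u) (dx f) (D_plus c g) Hnu Ha Hc Hlr HT
    ltac:(sm) ltac:(apply smooth2_dx, Hf) ltac:(now apply smooth1_D_plus)) as H.
  rewrite <- dx_Lgen in H by auto.
  specialize (H ltac:(apply eqR_dx; [auto | sm | apply Hf | exact He])).
  pose proof (Bf 1%nat 0%nat ltac:(lia)) as B1. change (partial_derive 1 0 f) with (dx f) in B1.
  pose proof (bound1_D_plus 0 c 0 T M g HT Hg Bg 0%nat ltac:(lia)) as B2.
  change (RInt (fun t => D_plus c g t ^ 2) 0 T <= (2 + 2 * c ^ 2) * M) in B2.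
  pose proof (Bu 1%nat ltac:(lia)) as B3.
  change (RInt (fun x => dx u x 0 ^ 2) l r <= M) in B3.
  refine (Rle_trans _ _ _ (H _ _) _).
  - intros t Ht. specialize (He l t ltac:(lra) Ht).
    rewrite (proj1 (C0inf_cyl_left l r T f Hf t ltac:(lra))) in He.
    rewrite <- (eqI_D_plus c 0 T (fun t => u l t) g HT ltac:(now apply smooth1_trace_t) Hg Hi t Ht).
    unfold Lgen in He. unfold D_plus. change (dxx u l t) with (dx (dx u) l t) in He.
    change (Derive (fun t => u l t) t) with (dt u l t). lra.
  - intros t Ht. specialize (Hr t Ht). change (dxx u r t) with (dx (dx u) r t) in Hr.
    rewrite Hr. ring.
  - assert (0 < / (2 * c)) by (apply Rinv_0_lt_compat; lra).
    assert (0 < / a) by (apply Rinv_0_lt_compat; lra).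
    unfold Rdiv. pose proof (Rmult_le_compat_l _ _ _ (Rlt_le _ _ H0) B1).
    pose proof (Rmult_le_compat_l _ _ _ (Rlt_le _ _ H1) B2). lra.
Qed.

(* [u_xx] vanishes at the outflow end and [nu u_xxx = a u_xx + (d_t + c) u_x] at the
   inflow end. *)
Lemma viscous_dxx_estimate (nu a c l r T M : R) f g u :
  0 < a -> 0 < c -> l < r -> 0 < T -> 0 < nu -> viscous nu a c l r T f g u ->
  bounded_data 2 2 l r T M f g u ->
  c / 2 * sqL2_2 l r T (dxx u)
  <= / (2 * c) * M + / a * RInt (fun t => dx (dt_plus c u) l t ^ 2) 0 T + / 2 * M.
Proof.
  intros Ha Hc Hlr HT Hnu Hv [Bf Bg Bu].
  pose proof (viscous_outflow_dxx nu a c l r T f g u Hnu Hlr HT Hv) as Hr.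
  destruct Hv as [Hu Hf Hg He Hi Ho]. assert (Hfs : smooth2 f) by apply Hf.
  pose proof (inflow_estimate nu a c l r T (dxx u) (dxx f) (fun t => dx (dt_plus c u) l t)
    Hnu Ha Hc Hlr HT ltac:(sm) ltac:(sm) ltac:(apply smooth1_trace_t; sm)) as H.
  rewrite (dxE u), <- !dx_Lgen, <- dxE, <- (dxE u) in H by sm.
  specialize (H ltac:(apply (eqR_dx l r T (dx (Lgen nu a c u)) (dx f)); [auto | sm | sm |];
    apply eqR_dx; [auto | sm | sm | exact He])).
  pose proof (Bf 2%nat 0%nat ltac:(lia)) as B1. change (partial_derive 2 0 f) with (dxx f) in B1.
  pose proof (Bu 2%nat ltac:(lia)) as B3.
  change (RInt (fun x => dxx u x 0 ^ 2) l r <= M) in B3.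
  pose proof (RInt_sqr_nonneg 0 T (fun t => dxx u l t) (Rlt_le _ _ HT) ltac:(ct)) as N1.
  pose proof (sqL2_2_nonneg l r T (dx (dxx u)) Hlr HT ltac:(ct)) as N2.
  assert (N3 : 0 < / (2 * c)) by (apply Rinv_0_lt_compat; lra).
  pose proof (Rmult_le_compat_l _ _ _ (Rlt_le _ _ N3) B1).
  enough (nu * sqL2_2 l r T (dx (dxx u)) + c / 2 * sqL2_2 l r T (dxx u) +
    a / 4 * RInt (fun t : R => dxx u l t ^ 2) 0 T <=
    / (2 * c) * sqL2_2 l r T (dxx f) +
    / a * RInt (fun t : R => dx (dt_plus c u) l t ^ 2) 0 T +
    / 2 * RInt (fun x : R => dxx u x 0 ^ 2) l r) by nra.
  apply H.
  - intros t Ht.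
    pose proof (eqR_dx l r T _ _ Hlr (smooth2_Lgen nu a c u Hu) Hfs He l t ltac:(lra) Ht) as Hd.
    rewrite dx_Lgen in Hd by auto.
    rewrite (proj2 (C0inf_cyl_left l r T f Hf t ltac:(lra))) in Hd.
    rewrite dx_dt_plus by auto. unfold Lgen in Hd. unfold dt_plus.
    change (dxx (dx u) l t) with (dx (dxx u) l t) in Hd.
    change (dx (dx u) l t) with (dxx u l t) in Hd. lra.
  - intros t Ht. rewrite Hr by auto. ring.
Qed.

(** * Bounds on the viscous solution uniform in the viscosity *)

Lemma RInt_sqr_le (l r : R) (g : R -> R) : l < r -> Cont1 g ->
  RInt g l r ^ 2 <= (r - l) * RInt (fun s => g s ^ 2) l r.
Proof.
  (* This is the Cauchy-Schwarz inequality against the constant 1, obtained from the nonnegative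
     integral of the squared deviation of [g] from its mean [m]. *)
  intros Hlr Hg. set (m := RInt g l r / (r - l)).
  assert (H : 0 <= RInt (fun s => (g s - m) ^ 2) l r).
  { apply RInt_nonneg; [lra | ct |]. intros s _. apply pow2_ge_0. }
  rewrite (RInt_ext_open _ (fun s => g s ^ 2 + ((- 2 * m) * g s + m ^ 2))) in H.
  2: lra. 2: intros s _; ring.
  rewrite !RInt_plus_Cont1, RInt_scal_Cont1, RInt_const in H by ct.
  change (scal (r - l) (m ^ 2)) with ((r - l) * m ^ 2) in H.
  assert (E : m * (r - l) = RInt g l r) by (unfold m; field; lra).
  rewrite <- E in *. nra.
Qed.

Lemma RInt_mono_right (l x r : R) (g : R -> R) : l <= x <= r -> Cont1 g ->
  (forall s, 0 <= g s) -> RInt g l x <= RInt g l r.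
Proof.
  intros Hx Hg H.
  rewrite <- (RInt_Chasles (V := R_CompleteNormedModule) g l x r) by now apply Cont1_ex_RInt.
  change (RInt g l x <= RInt g l x + RInt g x r).
  pose proof (RInt_nonneg g x r ltac:(lra) Hg ltac:(auto)). lra.
Qed.

Lemma sqr_le_inflow (l r : R) (u : R -> R -> R) (x t : R) : smooth2 u -> l < x < r ->
  u x t ^ 2 <= 2 * u l t ^ 2 + 2 * (r - l) * RInt (fun y => dx u y t ^ 2) l r.
Proof.
  intros Hu Hx.
  assert (E : RInt (fun y => dx u y t) l x = u x t - u l t).
  { change (fun y => dx u y t) with (Derive (fun y => u y t)).
    apply (RInt_Derive (fun y => u y t)).
    - intros y _. now apply smooth2_ex_derive_x.
    - intros y _. apply smooth1_continuous, smooth1_Derive. now apply smooth1_trace_x. }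
  pose proof (RInt_sqr_le l x (fun y => dx u y t) ltac:(lra) ltac:(ct)) as H1.
  pose proof (RInt_mono_right l x r (fun y => dx u y t ^ 2) ltac:(lra) ltac:(ct)
    ltac:(intros; apply pow2_ge_0)) as H2.
  pose proof (RInt_sqr_nonneg l x (fun y => dx u y t) ltac:(lra) ltac:(ct)) as H3.
  rewrite E in H1.
  assert ((x - l) * RInt (fun y => dx u y t ^ 2) l x
    <= (r - l) * RInt (fun y => dx u y t ^ 2) l r) by (apply Rmult_le_compat; lra).
  pose proof (pow2_ge_0 (u x t - 2 * u l t)). nra.
Qed.

(** At each time [u ^ 2] is bounded independently of [x] by its inflow value and [u_x], so the
    weight can be integrated alone. The whole gain of the layer norm is thus the mass [kap] of the
    weight, and only a uniform bound on [u_x] is needed. *)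
Lemma wsq_le_inflow (l r T lam kap : R) (u : R -> R -> R) : l < 0 < r -> 0 < T ->
  smooth2 u -> RInt (fun x => exp (- lam * x)) 0 r <= kap ->
  wsq 0 r T lam u
  <= kap * (2 * RInt (fun t => u l t ^ 2) 0 T + 2 * (r - l) * sqL2_2 l r T (dx u)).
Proof.
  intros Hlr HT Hu Hk.
  set (S := fun t => 2 * u l t ^ 2 + 2 * (r - l) * RInt (fun y => dx u y t ^ 2) l r).
  assert (Hi : Cont1 (fun t => RInt (fun y => dx u y t ^ 2) l r))
    by (apply (Cont1_RInt_param (fun y t => dx u y t ^ 2)); [lra | ct]).
  assert (HS : Cont1 S) by (unfold S; ct).
  assert (HS0 : forall t, 0 <= S t).
  { intros t. pose proof (pow2_ge_0 (u l t)).
    pose proof (RInt_sqr_nonneg l r (fun y => dx u y t) ltac:(lra) ltac:(ct)).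
    unfold S. nra. }
  replace (2 * RInt (fun t => u l t ^ 2) 0 T + 2 * (r - l) * sqL2_2 l r T (dx u))
    with (RInt S 0 T).
  2:{ unfold S, sqL2_2. rewrite RInt_plus_Cont1, !RInt_scal_Cont1 by ct. reflexivity. }
  rewrite <- RInt_scal_Cont1 by auto. unfold wsq, I2.
  apply RInt_le_Cont1; [lra | apply Cont1_RInt_param; [lra | ct] | ct |].
  intros t _.
  apply Rle_trans with (RInt (fun x => S t * exp (- lam * x)) 0 r).
  - apply RInt_le_Cont1; [lra | ct | ct |]. intros x Hx.
    rewrite Rmult_comm. apply Rmult_le_compat_r; [left; apply exp_pos|].
    apply sqr_le_inflow; auto. lra.
  - rewrite RInt_scal_Cont1 by ct. rewrite Rmult_comm. now apply Rmult_le_compat_r.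
Qed.

Lemma RInt_exp_le (lam r : R) : 0 < lam -> 0 < r ->
  RInt (fun x => exp (- lam * x)) 0 r <= / lam.
Proof.
  intros Hlam Hr.
  assert (H : is_RInt (fun x => exp (- lam * x)) 0 r
    (minus (- / lam * exp (- lam * r)) (- / lam * exp (- lam * 0)))).
  { apply (is_RInt_derive (fun x => - / lam * exp (- lam * x))).
    - intros x _. auto_derive; [exact I|]. field. lra.
    - intros x _. apply Cont1_exp. }
  rewrite (is_RInt_unique _ _ _ _ H), Rmult_0_r, exp_0.
  change (- / lam * exp (- lam * r) - - / lam * 1 <= / lam).
  assert (0 < / lam) by now apply Rinv_0_lt_compat.
  pose proof (exp_pos (- lam * r)). nra.
Qed.

Lemma sqL2_2_restrict (l l' r T : R) (u : R -> R -> R) : l <= l' < r -> 0 < T -> Cont2 u ->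
  sqL2_2 l' r T u <= sqL2_2 l r T u.
Proof.
  intros Hl HT Hu. unfold sqL2_2. apply RInt_le_Cont1; [lra | | |].
  1, 2: apply (Cont1_RInt_param (fun x t => u x t ^ 2)); [lra | ct].
  intros t _.
  rewrite <- (RInt_Chasles (V := R_CompleteNormedModule) (fun x => u x t ^ 2) l l' r)
    by (apply Cont1_ex_RInt; ct).
  change (RInt (fun x => u x t ^ 2) l' r
    <= RInt (fun x => u x t ^ 2) l l' + RInt (fun x => u x t ^ 2) l' r).
  pose proof (RInt_sqr_nonneg l l' (fun x => u x t) ltac:(lra) ltac:(ct)). lra.
Qed.

Section Bounds.
Context (a c l r T : R) (Ha : 0 < a) (Hc : 0 < c) (Hlr : l < 0 < r) (HT : 0 < T).

Lemma viscous_dx_bound : exists C, 0 < C /\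
  forall nu M f g u, 0 < nu <= 1 -> 0 <= M -> viscous nu a c l r T f g u ->
  bounded_data 1 1 l r T M f g u ->
  nu * sqL2_2 l r T (dxx u) <= C * M /\ sqL2_2 l r T (dx u) <= C * M /\
  RInt (fun t => dx u l t ^ 2) 0 T <= C * M.
Proof.
  set (A := / (2 * c) + (2 + 2 * c ^ 2) / a + / 2).
  assert (HA : 0 < A).
  { assert (0 < / (2 * c)) by (apply Rinv_0_lt_compat; lra).
    assert (0 < (2 + 2 * c ^ 2) / a) by (apply Rdiv_lt_0_compat; nra).
    unfold A. lra. }
  assert (H1 : 0 < A / (c / 2)) by (apply Rdiv_lt_0_compat; lra).
  assert (H2 : 0 < A / (a / 4)) by (apply Rdiv_lt_0_compat; lra).
  exists (A + A / (c / 2) + A / (a / 4)). split; [lra|].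
  intros nu M f g u Hnu HM Hv Hb.
  pose proof (viscous_dx_estimate nu a c l r T M f g u Ha Hc ltac:(lra) HT ltac:(lra) Hv Hb) as H.
  pose proof (viscous_smooth _ _ _ _ _ _ _ _ _ Hv) as Hu.
  pose proof (sqL2_2_nonneg l r T (dxx u) ltac:(lra) HT ltac:(ct)) as N1.
  pose proof (sqL2_2_nonneg l r T (dx u) ltac:(lra) HT ltac:(ct)) as N2.
  pose proof (RInt_sqr_nonneg 0 T (fun t => dx u l t) (Rlt_le _ _ HT) ltac:(ct)) as N3.
  fold A in H.
  assert (0 <= A * M) by nra. assert (0 <= A / (c / 2) * M) by nra.
  assert (0 <= A / (a / 4) * M) by nra.
  assert (nu * sqL2_2 l r T (dxx u) >= 0) by nra.
  repeat split.
  - nra.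
  - apply Rle_trans with (A / (c / 2) * M); [|nra].
    apply Rmult_le_reg_l with (c / 2); [lra|].
    replace (c / 2 * (A / (c / 2) * M)) with (A * M) by (field; lra). nra.
  - apply Rle_trans with (A / (a / 4) * M); [|nra].
    apply Rmult_le_reg_l with (a / 4); [lra|].
    replace (a / 4 * (A / (a / 4) * M)) with (A * M) by (field; lra). nra.
Qed.

(** The Robin datum for [u_xx] is the inflow trace of the [x] derivative of [(d_t + c) u]. Bounding
    it by [viscous_dx_bound] for [(d_t + c) u] accounts for the orders: one more for the data, and
    [1 + 2 = 3] for the initial trace. *)
Lemma viscous_dxx_bound : exists C, 0 < C /\
  forall nu M f g u, 0 < nu <= 1 -> 0 <= M -> viscous nu a c l r T f g u ->
  bounded_data 2 3 l r T M f g u -> sqL2_2 l r T (dxx u) <= C * M.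
Proof.
  destruct viscous_dx_bound as [C [HC H]].
  set (K := 2 + 2 * c ^ 2 + 2 * a ^ 2).
  assert (HK : 0 < K) by (unfold K; nra).
  assert (Hc2 : 0 < / (2 * c)) by (apply Rinv_0_lt_compat; lra).
  assert (Ha1 : 0 < / a) by (apply Rinv_0_lt_compat; lra).
  assert (HCK : 0 < / a * (C * K)) by (apply Rmult_lt_0_compat; nra).
  exists ((/ (2 * c) + / a * (C * K) + / 2) / (c / 2)).
  split; [apply Rdiv_lt_0_compat; lra|].
  intros nu M f g u Hnu HM Hv Hb.
  pose proof (viscous_dxx_estimate nu a c l r T M f g u Ha Hc ltac:(lra) HT ltac:(lra) Hv
    ltac:(now apply (bounded_data_le 2 2 3 2 l r T M M); auto; lra)) as H1.
  destruct (H nu (K * M) (dt_plus c f) (D_plus c g) (dt_plus c u) Hnu ltac:(nra)) as [_ [_ H2]].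
  - apply viscous_dt_plus; auto. lra.
  - apply (bounded_data_dt_plus 1 1 nu); auto. lra.
  - apply Rmult_le_reg_l with (c / 2); [lra|].
    replace (c / 2 * ((/ (2 * c) + / a * (C * K) + / 2) / (c / 2) * M))
      with (/ (2 * c) * M + / a * (C * (K * M)) + / 2 * M) by (field; lra).
    pose proof (Rmult_le_compat_l _ _ _ (Rlt_le _ _ Ha1) H2). lra.
Qed.

Lemma viscous_wsq_bound : exists C, 0 < C /\
  forall nu M lam kap f g u, 0 < nu <= 1 -> 0 <= M -> viscous nu a c l r T f g u ->
  bounded_data 1 1 l r T M f g u -> RInt (fun x => exp (- lam * x)) 0 r <= kap ->
  wsq 0 r T lam u <= kap * (C * M).
Proof.
  destruct viscous_dx_bound as [C [HC H]].
  exists (2 + 2 * (r - l) * C). split; [nra|].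
  intros nu M lam kap f g u Hnu HM Hv Hb Hk.
  destruct (H nu M f g u Hnu HM Hv Hb) as [_ [H2 _]].
  destruct Hv as [Hu Hf Hg He Hi Ho].
  apply Rle_trans with (1 := wsq_le_inflow l r T lam kap u Hlr HT Hu Hk).
  assert (E : RInt (fun t => u l t ^ 2) 0 T = sqL2_1 0 T g).
  { apply RInt_ext_open; [lra|]. intros t Ht. rewrite Hi by lra. reflexivity. }
  pose proof (bounded_inflow _ _ _ _ _ _ _ _ _ Hb 0%nat ltac:(lia)) as HB.
  change (sqL2_1 0 T g <= M) in HB.
  apply Rmult_le_compat_l.
  - apply Rle_trans with (2 := Hk). apply RInt_nonneg; [lra | ct |].
    intros; left; apply exp_pos.
  - rewrite E. nra.
Qed.

(** Here [(d_t + c) u] is replaced by [f + nu u_xx - a u_x] throughout the rectangle instead of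
    being estimated as a solution, so it costs no further derivative of the data. The control of
    [nu |u_xx|^2] suffices because [nu ^ 2 <= nu]. *)
Lemma viscous_dt_plus_bound : exists C, 0 < C /\
  forall nu M f g u, 0 < nu <= 1 -> 0 <= M -> viscous nu a c l r T f g u ->
  bounded_data 1 1 l r T M f g u -> sqL2_2 l r T (dt_plus c u) <= C * M.
Proof.
  destruct viscous_dx_bound as [C [HC H]].
  exists (4 * C + 4 * a ^ 2 * C + 2). split; [nra|].
  intros nu M f g u Hnu HM Hv Hb.
  destruct (H nu M f g u Hnu HM Hv Hb) as [H1 [H2 _]].
  destruct Hv as [Hu Hf Hg He Hi Ho]. assert (Hfs : smooth2 f) by apply Hf.
  pose proof (bounded_source _ _ _ _ _ _ _ _ _ Hb 0%nat 0%nat ltac:(lia)) as HB.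
  change (sqL2_2 l r T f <= M) in HB.
  assert (E : sqL2_2 l r T (dt_plus c u)
    = sqL2_2 l r T (fun x t => 1 * (fun x t => nu * dxx u x t + (- a) * dx u x t) x t + 1 * f x t)).
  { apply (I2_ext l r T ltac:(lra) HT). intros x t Hx Ht. f_equal.
    specialize (He x t ltac:(lra) ltac:(lra)). rewrite <- He. unfold Lgen, dt_plus. ring. }
  rewrite E.
  pose proof (sqL2_2_comb l r T 1 1 (fun x t => nu * dxx u x t + (- a) * dx u x t) f
    ltac:(lra) HT ltac:(ct) ltac:(ct)) as S1.
  pose proof (sqL2_2_comb l r T nu (- a) (dxx u) (dx u) ltac:(lra) HT ltac:(ct) ltac:(ct)) as S2.
  replace ((- a) ^ 2) with (a ^ 2) in S2 by ring.
  pose proof (sqL2_2_nonneg l r T (dxx u) ltac:(lra) HT ltac:(ct)) as N1.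
  pose proof (sqL2_2_nonneg l r T (dx u) ltac:(lra) HT ltac:(ct)) as N2.
  assert (nu ^ 2 * sqL2_2 l r T (dxx u) <= C * M) by nra.
  assert (a ^ 2 * sqL2_2 l r T (dx u) <= a ^ 2 * (C * M))
    by (apply Rmult_le_compat_l; [apply pow2_ge_0 | lra]).
  lra.
Qed.

End Bounds.

(** * Error equations *)

Lemma smooth2_iter (c : R) (j : nat) (u : R -> R -> R) :
  smooth2 u -> smooth2 (Nat.iter j (dt_plus c) u).
Proof. intros H. induction j; simpl; sm. Qed.

Lemma iter_dt_plus_comb (c p q : R) (j : nat) (u v : R -> R -> R) : smooth2 u -> smooth2 v ->
  Nat.iter j (dt_plus c) (fun x t => p * u x t + q * v x t)
  = fun x t => p * Nat.iter j (dt_plus c) u x t + q * Nat.iter j (dt_plus c) v x t.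
Proof.
  intros Hu Hv. induction j as [|j IH]; [reflexivity|]. simpl. rewrite IH.
  apply dt_plus_comb; now apply smooth2_iter.
Qed.

Lemma C0inf_cyl_iter (c l r T : R) (j : nat) (f : R -> R -> R) :
  C0inf_cyl l r T f -> C0inf_cyl l r T (Nat.iter j (dt_plus c) f).
Proof. intros H. induction j; simpl; [exact H|]. now apply C0inf_cyl_dt_plus. Qed.

(** Compatibility to infinite order at [t = 0], stated with [d_t + c] so that it is visibly
    inherited by every iterate to which an energy estimate is applied. *)
Definition flat (c l r : R) (w : R -> R -> R) : Prop :=
  forall j x, l <= x <= r -> Nat.iter j (dt_plus c) w x 0 = 0.

Lemma flat_dt_plus (c l r : R) (w : R -> R -> R) : flat c l r w -> flat c l r (dt_plus c w).
Proof. intros H j x Hx. rewrite <- Nat.iter_succ_r. now apply H. Qed.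

Lemma flat_comb (c l r p q : R) (u v : R -> R -> R) : smooth2 u -> smooth2 v ->
  flat c l r u -> flat c l r v -> flat c l r (fun x t => p * u x t + q * v x t).
Proof.
  intros Hu Hv Fu Fv j x Hx. rewrite iter_dt_plus_comb by auto.
  rewrite Fu, Fv by auto. ring.
Qed.

Lemma dx_initial (l r : R) (w : R -> R -> R) : l < r -> smooth2 w ->
  (forall x, l <= x <= r -> w x 0 = 0) -> forall x, l <= x <= r -> dx w x 0 = 0.
Proof.
  intros Hlr Hw H x Hx.
  transitivity (Derive (fun _ => 0) x); [|apply Derive_const].
  apply (eqI_Derive l r (fun x => w x 0) (fun _ => 0)); auto using smooth1_const.
  now apply smooth1_trace_x.
Qed.

Lemma flat_C0inf_cyl (c l r l' r' T : R) (f : R -> R -> R) : 0 < T -> C0inf_cyl l r T f ->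
  flat c l' r' f.
Proof.
  intros HT H j x _. apply (C0inf_cyl_initial l r T); auto. now apply C0inf_cyl_iter.
Qed.

(** If [w] vanishes at [t = 0], so do [w_x] and [w_xx], and the equation gives [w_t = F = 0] there.
    The induction repeats this for [(d_t + c) w], which solves the same equation with source
    [(d_t + c) F]. *)
Lemma flat_of_equation (c nu b k l r T : R) (w F : R -> R -> R) : l < r -> 0 < T ->
  smooth2 w -> smooth2 F -> eqR l r T (Lgen nu b k w) F -> flat c l r F ->
  (forall x, l <= x <= r -> w x 0 = 0) -> flat c l r w.
Proof.
  intros Hlr HT Hw HF He HfF H0 j. revert w F Hw HF He HfF H0.
  induction j as [|j IH]; intros w F Hw HF He HfF H0 x Hx; [now apply H0|].
  rewrite Nat.iter_succ_r. apply (IH (dt_plus c w) (dt_plus c F)); auto; try sm.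
  - rewrite <- Lgen_dt_plus by auto. apply eqR_dt_plus; auto. sm.
  - now apply flat_dt_plus.
  - intros y Hy. specialize (He y 0 Hy ltac:(lra)).
    pose proof (HfF 0%nat y Hy) as E0. simpl in E0.
    pose proof (dx_initial l r w Hlr Hw H0) as E1.
    pose proof (dx_initial l r (dx w) Hlr (smooth2_dx w Hw) E1 y Hy) as E2.
    specialize (E1 y Hy). specialize (H0 y Hy).
    unfold Lgen in He. change (dxx w y 0) with (dx (dx w) y 0) in He.
    unfold dt_plus. rewrite E1, E2, H0, E0 in He. rewrite H0. lra.
Qed.

Lemma trace_eq_dt_plus (c x y T : R) (v w : R -> R -> R) : 0 < T -> smooth2 v -> smooth2 w ->
  (forall t, 0 <= t <= T -> v x t = w y t) ->
  forall t, 0 <= t <= T -> dt_plus c v x t = dt_plus c w y t.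
Proof.
  intros HT Hv Hw H.
  exact (eqI_D_plus c 0 T (fun t => v x t) (fun t => w y t) HT
    (smooth1_trace_t v x Hv) (smooth1_trace_t w y Hw) H).
Qed.

Lemma trace_zero_dt_plus (c x T : R) (w : R -> R -> R) : 0 < T -> smooth2 w ->
  (forall t, 0 <= t <= T -> w x t = 0) -> forall t, 0 <= t <= T -> dt_plus c w x t = 0.
Proof.
  intros HT Hw H t Ht. transitivity (D_plus c (fun _ => 0) t); [|apply D_plus_0].
  apply (eqI_D_plus c 0 T (fun t => w x t) (fun _ => 0)); auto using smooth1_const.
  now apply smooth1_trace_t.
Qed.

Lemma dt_plus_scal (c k : R) (u : R -> R -> R) : smooth2 u ->
  dt_plus c (fun x t => k * u x t) = fun x t => k * dt_plus c u x t.
Proof.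
  intros Hu.
  transitivity (dt_plus c (fun x t => k * u x t + 0 * u x t)).
  - f_equal. apply functional_extensionality; intros x.
    apply functional_extensionality; intros t. ring.
  - rewrite dt_plus_comb by auto. apply functional_extensionality; intros x.
    apply functional_extensionality; intros t. ring.
Qed.

Lemma smooth2_scal (k : R) (u : R -> R -> R) : smooth2 u -> smooth2 (fun x t => k * u x t).
Proof.
  intros Hu. replace (fun x t => k * u x t) with (fun x t => k * u x t + 0 * u x t).
  - sm.
  - apply functional_extensionality; intros x.
    apply functional_extensionality; intros t. ring.
Qed.
#[global] Hint Resolve smooth2_scal smooth2_iter : sm.

(* [ea = u - u_a], [em = La u - u_ma], [ed = u - u_ad]. *)
Record error_system (nu a c L1 L2 T : R) (u ea em ed : R -> R -> R) : Prop := {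
  err_smooth : smooth2 u /\ smooth2 ea /\ smooth2 em /\ smooth2 ed;
  err_flat : flat c 0 L2 u /\ flat c 0 L2 ea /\ flat c 0 L2 em /\ flat c (- L1) 0 ed;
  err_a : eqR 0 L2 T (Lgen 0 a c ea) (fun x t => nu * dxx u x t);
  err_ma : eqR 0 L2 T (Lgen 0 (- a) (c + a ^ 2 / nu) em) (dt_plus c (dt_plus c ea));
  err_ma_outflow : forall t, 0 <= t <= T -> em L2 t = 0;
  err_ad : eqR (- L1) 0 T (Lgen nu a c ed) (fun _ _ => 0);
  err_ad_inflow : forall t, 0 <= t <= T -> ed (- L1) t = 0;
  err_ad_interface : forall t, 0 <= t <= T -> Lgen 0 a c ed 0 t = em 0 t }.

Lemma error_system_dt_plus (nu a c L1 L2 T : R) u ea em ed :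
  0 < T -> error_system nu a c L1 L2 T u ea em ed ->
  error_system nu a c L1 L2 T (dt_plus c u) (dt_plus c ea) (dt_plus c em) (dt_plus c ed).
Proof.
  intros HT [(Hu & Ha & Hm & Hd) (Fu & Fa & Fm & Fd) Ea Em EmL Ed Ed1 Edi].
  assert (Hz : dt_plus c (fun _ _ : R => 0) = fun _ _ => 0).
  { apply functional_extensionality; intros x. apply functional_extensionality; intros t.
    unfold dt_plus, dt. rewrite Derive_const. ring. }
  split.
  - repeat split; sm.
  - repeat split; now apply flat_dt_plus.
  - rewrite <- Lgen_dt_plus, dxx_dt_plus, <- dt_plus_scal by sm.
    apply eqR_dt_plus; auto; sm.
  - rewrite <- Lgen_dt_plus by auto. apply eqR_dt_plus; auto; sm.
  - now apply trace_zero_dt_plus.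
  - rewrite <- Lgen_dt_plus, <- Hz by auto. apply eqR_dt_plus; auto using smooth2_0; sm.
  - now apply trace_zero_dt_plus.
  - rewrite <- Lgen_dt_plus by auto. apply trace_eq_dt_plus; auto; sm.
Qed.

Lemma error_system_iter (nu a c L1 L2 T : R) (j : nat) u ea em ed :
  0 < T -> error_system nu a c L1 L2 T u ea em ed ->
  error_system nu a c L1 L2 T (Nat.iter j (dt_plus c) u) (Nat.iter j (dt_plus c) ea)
    (Nat.iter j (dt_plus c) em) (Nat.iter j (dt_plus c) ed).
Proof. intros HT H. induction j; simpl; [exact H|]. now apply error_system_dt_plus. Qed.

Lemma wsq_le_sqL2_2 (r T lam : R) (u : R -> R -> R) : 0 < r -> 0 < T -> 0 <= lam ->
  Cont2 u -> wsq 0 r T lam u <= sqL2_2 0 r T u.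
Proof.
  intros Hr HT Hlam Hu. rewrite <- (wsq_0 0 r T Hr HT). apply I2_le; ct.
  intros x t Hx _. apply Rmult_le_compat_r; [apply pow2_ge_0|].
  rewrite Ropp_0, Rmult_0_l. destruct (Rle_lt_or_eq_dec (- lam * x) 0) as [Hlt|He].
  - nra.
  - left. now apply exp_increasing.
  - rewrite He. lra.
Qed.

(** With [lam = a / nu] the damping is at least [a ^ 2 / (2 * nu)], so the inflow trace enters with
    a factor [nu] and the source with [nu ^ 2]. The weight on the source is simply bounded by 1. *)
Lemma advection_layer_estimate (nu a c L T : R) (w F : R -> R -> R) :
  0 < nu -> 0 < a -> 0 < c -> 0 < L -> 0 < T -> smooth2 w -> smooth2 F ->
  eqR 0 L T (Lgen 0 a c w) F -> flat c 0 L w ->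
  wsq 0 L T (a / nu) w <= 2 * nu / a * RInt (fun t => w 0 t ^ 2) 0 T
    + 4 * nu ^ 2 / a ^ 4 * sqL2_2 0 L T F.
Proof.
  intros Hnu Ha Hc HL HT Hw HF He Hf.
  assert (Hlam : 0 < a / nu) by now apply Rdiv_lt_0_compat.
  pose proof (advection_estimate a c L T (a / nu) w F Ha Hc HL HT ltac:(lra) Hw HF He
    (Hf 0%nat)) as H.
  pose proof (wsq_le_sqL2_2 L T (a / nu) F HL HT ltac:(lra) ltac:(ct)) as HN.
  pose proof (wsq_nonneg 0 L T HL HT (a / nu) F ltac:(ct)) as HP.
  pose proof (RInt_sqr_nonneg 0 T (fun t => w 0 t) (Rlt_le _ _ HT) ltac:(ct)) as HB.
  set (mu := c + a * (a / nu) / 2) in *.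
  assert (Hs : 0 < a ^ 2 / (2 * nu)) by (apply Rdiv_lt_0_compat; nra).
  assert (Hmu : a ^ 2 / (2 * nu) <= mu)
    by (replace mu with (c + a ^ 2 / (2 * nu)) by (unfold mu; field; lra); lra).
  assert (Hi : / mu <= 2 * nu / a ^ 2).
  { replace (2 * nu / a ^ 2) with (/ (a ^ 2 / (2 * nu))) by (field; lra).
    now apply Rinv_le_contravar. }
  assert (Hi0 : 0 < / mu) by (apply Rinv_0_lt_compat; lra).
  apply Rle_trans with (1 := H). apply Rplus_le_compat.
  - apply Rmult_le_compat_r; [exact HB|].
    replace (2 * nu / a) with (a * (2 * nu / a ^ 2)) by (field; lra).
    now apply Rmult_le_compat_l; [lra|].
  - apply Rmult_le_compat; auto.
    + rewrite <- pow_inv. apply pow2_ge_0.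
    + rewrite <- pow_inv. replace (4 * nu ^ 2 / a ^ 4) with ((2 * nu / a ^ 2) ^ 2) by (field; lra).
      apply pow_incr. lra.
Qed.

Section ErrorEstimates.
Context (nu a c L1 L2 T : R) (u ea em ed : R -> R -> R).
Context (Hnu : 0 < nu) (Ha : 0 < a) (Hc : 0 < c) (HL1 : 0 < L1) (HL2 : 0 < L2) (HT : 0 < T).
Context (HE : error_system nu a c L1 L2 T u ea em ed).

Lemma err_ma_estimate :
  RInt (fun t => em 0 t ^ 2) 0 T
  <= nu / a ^ 3 * wsq 0 L2 T (a / nu) (dt_plus c (dt_plus c ea)).
Proof.
  destruct HE as [(Hu & Hsa & Hm & Hd) (Fu & Fa & Fm & Fd) Ea Em EmL Ed Ed1 Edi].
  apply (modified_advection_estimate nu a c L2 T em); auto; try sm. exact (Fm 0%nat).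
Qed.

Lemma err_ad_estimate :
  RInt (fun t => ed 0 t ^ 2) 0 T <= 4 * nu ^ 2 / a ^ 4 * RInt (fun t => em 0 t ^ 2) 0 T /\
  sqL2_2 (- L1) 0 T ed <= 8 * nu ^ 3 / a ^ 5 * RInt (fun t => em 0 t ^ 2) 0 T.
Proof.
  destruct HE as [(Hu & Hsa & Hm & Hd) (Fu & Fa & Fm & Fd) Ea Em EmL Ed Ed1 Edi].
  apply (boundary_layer_estimate nu a c (- L1) T ed (fun t => em 0 t)); auto; try lra.
  - now apply smooth1_trace_t.
  - exact (Fd 0%nat).
Qed.

Lemma err_a_estimate :
  sqL2_2 0 L2 T ea
  <= a / c * RInt (fun t => ea 0 t ^ 2) 0 T + nu ^ 2 / c ^ 2 * sqL2_2 0 L2 T (dxx u).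
Proof.
  destruct HE as [(Hu & Hsa & Hm & Hd) (Fu & Fa & Fm & Fd) Ea Em EmL Ed Ed1 Edi].
  pose proof (advection_estimate a c L2 T 0 ea (fun x t => nu * dxx u x t) Ha Hc HL2 HT (Rle_refl 0) Hsa
    ltac:(sm) Ea (Fa 0%nat)) as H.
  rewrite (wsq_scal 0 L2 T HL2 HT 0 nu) in H by ct.
  rewrite !wsq_0 in H by auto.
  replace (c + a * 0 / 2) with c in H by field.
  replace (/ c ^ 2 * (nu ^ 2 * sqL2_2 0 L2 T (dxx u)))
    with (nu ^ 2 / c ^ 2 * sqL2_2 0 L2 T (dxx u)) in H by (field; lra).
  exact H.
Qed.

Lemma err_a_layer_estimate :
  wsq 0 L2 T (a / nu) ea
  <= 2 * nu / a * RInt (fun t => ea 0 t ^ 2) 0 T + 4 * nu ^ 4 / a ^ 4 * sqL2_2 0 L2 T (dxx u).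
Proof.
  destruct HE as [(Hu & Hsa & Hm & Hd) (Fu & Fa & Fm & Fd) Ea Em EmL Ed Ed1 Edi].
  pose proof (advection_layer_estimate nu a c L2 T ea (fun x t => nu * dxx u x t) Hnu Ha Hc HL2 HT Hsa ltac:(sm) Ea Fa) as H.
  rewrite <- (wsq_0 0 L2 T HL2 HT (fun x t => nu * dxx u x t)), wsq_scal, wsq_0 in H by (auto; ct).
  replace (4 * nu ^ 2 / a ^ 4 * (nu ^ 2 * sqL2_2 0 L2 T (dxx u)))
    with (4 * nu ^ 4 / a ^ 4 * sqL2_2 0 L2 T (dxx u)) in H by (field; lra).
  exact H.
Qed.

End ErrorEstimates.

(** * The error system of one pass *)

Lemma Lgen_comb (nu b k p q : R) (u v : R -> R -> R) : smooth2 u -> smooth2 v ->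
  Lgen nu b k (fun x t => p * u x t + q * v x t)
  = fun x t => p * Lgen nu b k u x t + q * Lgen nu b k v x t.
Proof.
  intros Hu Hv. apply functional_extensionality; intros x.
  apply functional_extensionality; intros t. unfold Lgen.
  rewrite !dxE, dt_comb, !dx_comb by sm. ring.
Qed.

Lemma La_Lgen (a c : R) (u : R -> R -> R) : La a c u = Lgen 0 a c u.
Proof.
  apply functional_extensionality; intros x. apply functional_extensionality; intros t.
  unfold La, Lgen. ring.
Qed.

Lemma Lma_Lgen (nu a c : R) (u : R -> R -> R) : Lma nu a c u = Lgen 0 (- a) (c + a ^ 2 / nu) u.
Proof.
  apply functional_extensionality; intros x. apply functional_extensionality; intros t.
  unfold Lma, Lgen. ring.
Qed.

(** With [S = d_t + c], which commutes with [d_x], the cross terms of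
    [(S - a d_x + a^2 / nu) (S + a d_x)] cancel. The rest is
    [S^2 + (a^2 / nu) (S + a d_x - nu d_x^2)]. *)
Lemma factorization (nu a c : R) (u : R -> R -> R) (x t : R) : nu <> 0 -> smooth2 u ->
  Lgen 0 (- a) (c + a ^ 2 / nu) (Lgen 0 a c u) x t
  = Rop c u x t + a ^ 2 / nu * Lgen nu a c u x t.
Proof.
  intros Hnu Hu.
  assert (E1 : forall v, Lgen 0 a c v x t = dt_plus c v x t + a * dx v x t)
    by (intros v; unfold Lgen, dt_plus; ring).
  assert (E2 : forall v, Lgen 0 (- a) (c + a ^ 2 / nu) v x t
    = dt_plus c v x t - a * dx v x t + a ^ 2 / nu * v x t)
    by (intros v; unfold Lgen, dt_plus; ring).
  rewrite E2, Lgen_dt_plus, dx_Lgen, !E1, dx_dt_plus by auto.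
  unfold Rop, Lgen. change (dx (dx u) x t) with (dxx u x t).
  change (dt_plus c u x t) with (dt u x t + c * u x t). field. exact Hnu.
Qed.

Lemma viscous_of_solution (nu a c L1 L2 T : R) f h g1 g2 u :
  0 < L1 -> 0 < L2 -> 0 < T -> C0inf_cyl (- L1) L2 T f -> C0inf_time T g1 ->
  (forall t, g2 t = 0) -> viscous_solution nu a c L1 L2 T f h g1 g2 u ->
  viscous nu a c (- L1) L2 T f g1 u.
Proof.
  intros HL1 HL2 HT Hf Hg Hg2 (Hu & He & Hi & Ho & H0). split; auto.
  - apply Hg.
  - apply eqR_of_open; auto; [lra | sm | apply Hf].
  - apply (eqI_of_open 0 T (fun t => u (- L1) t) g1); auto; [now apply smooth1_trace_t | apply Hg].
  - apply (eqI_of_open 0 T (fun t => Lgen 0 a c u L2 t) (fun _ => 0)); auto using smooth1_const.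
    + apply smooth1_trace_t. sm.
    + intros t Ht. rewrite <- La_Lgen, <- (Hg2 t). now apply Ho.
Qed.

Lemma eqR_sub (l r l' r' T : R) (u v : R -> R -> R) : l <= l' -> r' <= r ->
  eqR l r T u v -> eqR l' r' T u v.
Proof. intros Hl Hr H x t Hx Ht. apply H; lra. Qed.

(** The errors are written with coefficients [1] and [- 1] so that they have the shape of the
    linear-combination lemmas. The facts on [ua] alone are returned as well, because the first pass
    estimates [u] and [ua] separately. *)
Lemma error_system_of_pass (nu a c L1 L2 T : R) f h g1 g2 gad u ua uma uad :
  0 < nu -> 0 < L1 -> 0 < L2 -> 0 < T ->
  C0inf_open (- L1) 0 h -> C0inf_cyl (- L1) L2 T f -> C0inf_time T g1 ->
  (forall t, g2 t = 0) -> smooth1 gad ->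
  viscous_solution nu a c L1 L2 T f h g1 g2 u ->
  factorization_iteration nu a c L1 L2 T f h g1 g2 gad ua uma uad ->
  (smooth2 ua /\ eqR 0 L2 T (Lgen 0 a c ua) f /\ flat c 0 L2 ua /\
   forall t, 0 <= t <= T -> ua 0 t = gad t) /\
  error_system nu a c L1 L2 T u (fun x t => 1 * u x t + (- 1) * ua x t)
    (fun x t => 1 * Lgen 0 a c u x t + (- 1) * uma x t)
    (fun x t => 1 * u x t + (- 1) * uad x t).
Proof.
  intros Hnu HL1 HL2 HT Hh Hf Hg1 Hg2 Hgad Hv ((Sa & Ea & Ia & Za) & (Sm & Em & Om & Zm) & (Sd & Ed & Id & Jd & Zd)).
  pose proof (viscous_of_solution nu a c L1 L2 T f h g1 g2 u HL1 HL2 HT Hf Hg1 Hg2 Hv) as HV.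
  destruct Hv as (Hu & _ & _ & _ & Zu). destruct HV as [_ _ Sg He Hi Ho].
  assert (Hfs : smooth2 f) by apply Hf.
  destruct Hh as [Hhs (al & be & Hal & Hbe & Hh)].
  assert (Z0 : forall w : R -> R -> R, smooth2 w -> (forall x, 0 < x < L2 -> w x 0 = 0) ->
    forall x, 0 <= x <= L2 -> w x 0 = 0).
  { intros w Hw H. apply (eqI_of_open 0 L2 (fun x => w x 0) (fun _ => 0)); auto using smooth1_const.
    now apply smooth1_trace_x. }
  (* The support of [h] ends strictly to the left of 0, hence zero initial values on all of
     [[0, L2]]. *)
  assert (Zu' : forall x, 0 <= x <= L2 -> u x 0 = 0).
  { apply Z0; auto. intros x Hx. rewrite Zu by lra. apply Hh. lra. }
  assert (Za' : forall x, 0 <= x <= L2 -> ua x 0 = 0).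
  { apply Z0; auto. intros x Hx. rewrite Za by lra. apply Hh. lra. }
  assert (He2 : eqR 0 L2 T (Lgen nu a c u) f) by (apply (eqR_sub (- L1) L2); auto; lra).
  assert (He1 : eqR (- L1) 0 T (Lgen nu a c u) f) by (apply (eqR_sub (- L1) L2); auto; lra).
  assert (Ea' : eqR 0 L2 T (Lgen 0 a c ua) f).
  { apply eqR_of_open; auto; [sm|]. intros x t Hx Ht. rewrite <- La_Lgen. now apply Ea. }
  assert (Ff : flat c 0 L2 f) by now apply (flat_C0inf_cyl c (- L1) L2 0 L2 T).
  assert (Fu : flat c 0 L2 u) by now apply (flat_of_equation c nu a c 0 L2 T u f).
  assert (Fa : flat c 0 L2 ua) by now apply (flat_of_equation c 0 a c 0 L2 T ua f).
  split; [repeat split; auto|].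
  { apply (eqI_of_open 0 T (fun t => ua 0 t) gad); auto. now apply smooth1_trace_t. }
  set (ea := fun x t => 1 * u x t + (- 1) * ua x t).
  set (em := fun x t => 1 * Lgen 0 a c u x t + (- 1) * uma x t).
  set (ed := fun x t => 1 * u x t + (- 1) * uad x t).
  assert (Sea : smooth2 ea) by (unfold ea; sm).
  assert (Sem : smooth2 em) by (unfold em; sm).
  assert (Sed : smooth2 ed) by (unfold ed; sm).
  assert (Fea : flat c 0 L2 ea) by now apply flat_comb.
  assert (Eem : eqR 0 L2 T (Lgen 0 (- a) (c + a ^ 2 / nu) em) (dt_plus c (dt_plus c ea))).
  { apply eqR_of_open; auto; [sm | sm |]. intros x t Hx Ht.
    unfold em, ea. rewrite Lgen_comb, !dt_plus_comb by sm.
    rewrite factorization, He2, <- Lma_Lgen, Em by (auto; lra). unfold Rop. ring. }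
  assert (Eed : eqR (- L1) 0 T (Lgen nu a c ed) (fun _ _ => 0)).
  { apply eqR_of_open; auto using smooth2_0; [lra | sm |]. intros x t Hx Ht.
    unfold ed. rewrite Lgen_comb by sm. rewrite He1 by lra.
    change (Lgen nu a c uad x t) with (Lad nu a c uad x t). rewrite Ed by auto. ring. }
  split; auto.
  - repeat split; auto.
    + apply (flat_of_equation c 0 (- a) (c + a ^ 2 / nu) 0 L2 T em (dt_plus c (dt_plus c ea)));
        auto; [sm | now apply flat_dt_plus, flat_dt_plus |].
      (* The initial value prescribed in the modified advection step is exactly [La u] at [t = 0]:
         by the viscous equation [La u = f + nu u_xx], and [u] starts from [h]. *)
      apply Z0; auto. intros x Hx. unfold em. rewrite Zm by lra.
      pose proof (He2 x 0 ltac:(lra) ltac:(lra)) as E0.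
      rewrite (C0inf_cyl_initial (- L1) L2 T f HT Hf) in E0 |- *.
      assert (Ed2 : Derive_n h 2 x = dxx u x 0).
      { apply Derive_n_ext_loc. apply (locally_open_interval (- L1) L2); [lra|].
        intros y Hy. symmetry. now apply Zu. }
      rewrite Ed2. unfold Lgen in E0 |- *. lra.
    + apply (flat_of_equation c nu a c (- L1) 0 T ed (fun _ _ => 0)); auto using smooth2_0; [lra | |].
      (* Writing 0 as [f - f] obtains its flatness from that of [f]. *)
      * replace (fun _ _ : R => 0) with (fun x t => 1 * f x t + (- 1) * f x t).
        { apply flat_comb; auto; now apply (flat_C0inf_cyl c (- L1) L2 (- L1) 0 T). }
        apply functional_extensionality; intros x. apply functional_extensionality; intros t. ring.
      * apply (eqI_of_open (- L1) 0 (fun x => ed x 0) (fun _ => 0)); auto using smooth1_const;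
          [lra | now apply smooth1_trace_x |].
        intros x Hx. unfold ed. rewrite Zd, Zu by lra. ring.
  - intros x t Hx Ht. unfold ea. rewrite Lgen_comb by auto. rewrite Ea' by auto.
    specialize (He2 x t Hx Ht). rewrite <- He2. unfold Lgen. ring.
  - apply (eqI_of_open 0 T (fun t => em L2 t) (fun _ => 0)); auto using smooth1_const.
    + now apply smooth1_trace_t.
    + intros t Ht. unfold em. rewrite Ho, Om, Hg2 by lra. ring.
  - apply (eqI_of_open 0 T (fun t => ed (- L1) t) (fun _ => 0)); auto using smooth1_const.
    + now apply smooth1_trace_t.
    + intros t Ht. unfold ed. rewrite Id, Hi by lra. ring.
  - apply (eqI_of_open 0 T (fun t => Lgen 0 a c ed 0 t) (fun t => em 0 t)); auto.
    + apply smooth1_trace_t. sm.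
    + now apply smooth1_trace_t.
    + intros t Ht. unfold ed, em. rewrite Lgen_comb by auto.
      rewrite <- (La_Lgen a c uad), Jd by lra. reflexivity.
Qed.

(** * From Sobolev norms to bounds on single derivatives *)

Lemma sum_f_R0_term_le (F : nat -> R) (n k : nat) : (forall i, 0 <= F i) -> (k <= n)%nat ->
  F k <= sum_f_R0 F n.
Proof.
  intros HF Hk. induction n as [|n IH].
  - replace k with 0%nat by lia. simpl. lra.
  - simpl. pose proof (HF (S n)). destruct (Nat.eq_dec k (S n)) as [->|Hn].
    + pose proof (cond_pos_sum F n HF). lra.
    + specialize (IH ltac:(lia)). lra.
Qed.

Lemma sqL2_1_Derive_n_nonneg (l r : R) (g : R -> R) (j : nat) : l <= r -> smooth1 g ->
  0 <= sqL2_1 l r (Derive_n g j).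
Proof.
  intros Hlr Hg. apply RInt_sqr_nonneg; auto. now apply Cont1_smooth, smooth1_Derive_n.
Qed.

Lemma bound1_sqH_1 (k : nat) (l r : R) (g : R -> R) : l <= r -> smooth1 g ->
  bound1 k l r (sqH_1 k l r g) g.
Proof.
  intros Hlr Hg p Hp. apply (sum_f_R0_term_le (fun j => sqL2_1 l r (Derive_n g j))); auto.
  intros i. now apply sqL2_1_Derive_n_nonneg.
Qed.

Lemma sqH_1_nonneg (k : nat) (l r : R) (g : R -> R) : l <= r -> smooth1 g ->
  0 <= sqH_1 k l r g.
Proof. intros Hlr Hg. apply cond_pos_sum. intros i. now apply sqL2_1_Derive_n_nonneg. Qed.

Lemma sqL2_2_partial_derive_nonneg (l r T : R) (f : R -> R -> R) (i j : nat) :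
  l < r -> 0 < T -> smooth2 f -> 0 <= sqL2_2 l r T (partial_derive i j f).
Proof.
  intros Hlr HT Hf. apply sqL2_2_nonneg; auto. now apply Cont2_smooth, smooth2_partial_derive.
Qed.

Lemma bound2_sqH_2 (k : nat) (l r T : R) (f : R -> R -> R) : l < r -> 0 < T -> smooth2 f ->
  bound2 k l r T (sqH_2 k l r T f) f.
Proof.
  intros Hlr HT Hf i p Hip.
  apply Rle_trans with (sum_f_R0 (fun j => sqL2_2 l r T (partial_derive i j f)) (k - i)).
  - apply (sum_f_R0_term_le (fun j => sqL2_2 l r T (partial_derive i j f))); [|lia].
    intros j. now apply sqL2_2_partial_derive_nonneg.
  - apply (sum_f_R0_term_le (fun i => sum_f_R0 (fun j =>
      sqL2_2 l r T (partial_derive i j f)) (k - i))); [|lia].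
    intros m. apply cond_pos_sum. intros j. now apply sqL2_2_partial_derive_nonneg.
Qed.

Lemma sqH_2_nonneg (k : nat) (l r T : R) (f : R -> R -> R) : l < r -> 0 < T -> smooth2 f ->
  0 <= sqH_2 k l r T f.
Proof.
  intros Hlr HT Hf. apply cond_pos_sum. intros m. apply cond_pos_sum. intros j.
  now apply sqL2_2_partial_derive_nonneg.
Qed.

Lemma data_bound_nonneg (k : nat) (L1 L2 T : R) f h g1 : 0 < L1 -> 0 < L2 -> 0 < T ->
  smooth2 f -> smooth1 h -> smooth1 g1 -> 0 <= data_bound k L1 L2 T f h g1.
Proof.
  intros HL1 HL2 HT Hf Hh Hg. unfold data_bound.
  pose proof (sqH_2_nonneg k (- L1) L2 T f ltac:(lra) HT Hf).
  pose proof (sqH_1_nonneg k (- L1) L2 h ltac:(lra) Hh).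
  pose proof (sqH_1_nonneg k 0 T g1 ltac:(lra) Hg). lra.
Qed.

Lemma bounded_data_of_solution (k : nat) (nu a c L1 L2 T : R) f h g1 g2 u :
  0 < L1 -> 0 < L2 -> 0 < T -> smooth2 f -> smooth1 h -> smooth1 g1 ->
  viscous_solution nu a c L1 L2 T f h g1 g2 u ->
  bounded_data k k (- L1) L2 T (data_bound k L1 L2 T f h g1) f g1 u.
Proof.
  intros HL1 HL2 HT Hf Hh Hg (_ & _ & _ & _ & Zu).
  pose proof (sqH_2_nonneg k (- L1) L2 T f ltac:(lra) HT Hf).
  pose proof (sqH_1_nonneg k (- L1) L2 h ltac:(lra) Hh).
  pose proof (sqH_1_nonneg k 0 T g1 ltac:(lra) Hg).
  unfold data_bound. split.
  - apply (bound2_le k k (- L1) L2 T (sqH_2 k (- L1) L2 T f)); [lia | lra |].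
    apply bound2_sqH_2; auto. lra.
  - apply (bound1_le k k 0 T (sqH_1 k 0 T g1)); [lia | lra |].
    apply bound1_sqH_1; auto. lra.
  - apply (bound1_ext k (- L1) L2 _ _ h); [lra | auto |].
    apply (bound1_le k k (- L1) L2 (sqH_1 k (- L1) L2 h)); [lia | lra |].
    apply bound1_sqH_1; auto. lra.
Qed.

(** * Convergence *)

Lemma iter_trace (c x t : R) (j : nat) (u : R -> R -> R) :
  Nat.iter j (dt_plus c) u x t = Nat.iter j (D_plus c) (fun t => u x t) t.
Proof.
  revert t. induction j as [|j IH]; intros t; [reflexivity|]. simpl.
  unfold dt_plus at 1, D_plus at 1, dt. rewrite IH. f_equal.
  apply Derive_ext. intros s. apply IH.
Qed.

Lemma smooth1_iter (c : R) (j : nat) (g : R -> R) :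
  smooth1 g -> smooth1 (Nat.iter j (D_plus c) g).
Proof. intros H. induction j; simpl; [exact H|]. now apply smooth1_D_plus. Qed.

Lemma eqI_iter (c T : R) (j : nat) (g h : R -> R) : 0 < T -> smooth1 g -> smooth1 h ->
  eqI 0 T g h -> eqI 0 T (Nat.iter j (D_plus c) g) (Nat.iter j (D_plus c) h).
Proof.
  intros HT Hg Hh H. induction j as [|j IH]; [exact H|]. simpl.
  apply eqI_D_plus; auto using smooth1_iter.
Qed.

Lemma bound2_iter (j k : nat) (c l r T M : R) (f : R -> R -> R) : l < r -> 0 < T ->
  smooth2 f -> bound2 (j + k) l r T M f ->
  bound2 k l r T ((2 + 2 * c ^ 2) ^ j * M) (Nat.iter j (dt_plus c) f).
Proof.
  intros Hlr HT. revert f M. induction j as [|j IH]; intros f M Hf H.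
  - simpl. now rewrite Rmult_1_l.
  - rewrite Nat.iter_succ_r.
    replace ((2 + 2 * c ^ 2) ^ S j * M)
      with ((2 + 2 * c ^ 2) ^ j * ((2 + 2 * c ^ 2) * M)) by (simpl; ring).
    apply IH; [sm|]. now apply bound2_dt_plus.
Qed.

Lemma bound1_iter (j k : nat) (c l r M : R) (g : R -> R) : l < r ->
  smooth1 g -> bound1 (j + k) l r M g ->
  bound1 k l r ((2 + 2 * c ^ 2) ^ j * M) (Nat.iter j (D_plus c) g).
Proof.
  intros Hlr. revert g M. induction j as [|j IH]; intros g M Hg H.
  - simpl. now rewrite Rmult_1_l.
  - rewrite Nat.iter_succ_r.
    replace ((2 + 2 * c ^ 2) ^ S j * M)
      with ((2 + 2 * c ^ 2) ^ j * ((2 + 2 * c ^ 2) * M)) by (simpl; ring).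
    apply IH; [now apply smooth1_D_plus|]. now apply bound1_D_plus.
Qed.

Lemma eqR_iter (c nu b k l r T : R) (j : nat) (w F : R -> R -> R) : 0 < T ->
  smooth2 w -> smooth2 F -> eqR l r T (Lgen nu b k w) F ->
  eqR l r T (Lgen nu b k (Nat.iter j (dt_plus c) w)) (Nat.iter j (dt_plus c) F).
Proof.
  intros HT Hw HF H. induction j as [|j IH]; [exact H|]. simpl.
  rewrite <- Lgen_dt_plus by sm. apply eqR_dt_plus; auto; sm.
Qed.

Lemma flat_iter (c l r : R) (j : nat) (w : R -> R -> R) :
  flat c l r w -> flat c l r (Nat.iter j (dt_plus c) w).
Proof. intros H. induction j; simpl; [exact H|]. now apply flat_dt_plus. Qed.

Section Constants.
Context (a c L1 L2 T : R) (Ha : 0 < a) (Hc : 0 < c) (HL1 : 0 < L1) (HL2 : 0 < L2) (HT : 0 < T).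

Definition advection_iterate (f : R -> R -> R) (gad : R -> R) (ua : R -> R -> R) : Prop :=
  smooth2 ua /\ eqR 0 L2 T (Lgen 0 a c ua) f /\ flat c 0 L2 ua /\
  forall t, 0 <= t <= T -> ua 0 t = gad t.

Lemma advection_iterate_trace (j : nat) (G : R) f gad ua : smooth1 gad ->
  advection_iterate f gad ua -> bound1 j 0 T G gad ->
  RInt (fun t => Nat.iter j (dt_plus c) ua 0 t ^ 2) 0 T <= (2 + 2 * c ^ 2) ^ j * G.
Proof.
  intros Hgad (Hu & _ & _ & Hi) HG.
  apply Rle_trans with (RInt (fun t => Nat.iter j (D_plus c) gad t ^ 2) 0 T).
  - right. apply RInt_ext_open; [lra|]. intros t Ht. f_equal. rewrite iter_trace.
    apply (eqI_iter c T j (fun t => ua 0 t) gad); auto using smooth1_trace_t. lra.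
  - apply (bound1_iter j 0 c 0 T G gad HT Hgad ltac:(now rewrite Nat.add_0_r) 0%nat). lia.
Qed.

Lemma advection_iterate_source (j : nat) (M : R) f : smooth2 f ->
  bound2 j (- L1) L2 T M f ->
  sqL2_2 0 L2 T (Nat.iter j (dt_plus c) f) <= (2 + 2 * c ^ 2) ^ j * M.
Proof.
  intros Hf HB.
  apply Rle_trans with (sqL2_2 (- L1) L2 T (Nat.iter j (dt_plus c) f)).
  - apply sqL2_2_restrict; [lra | lra | ct].
  - apply (bound2_iter j 0 c (- L1) L2 T M f ltac:(lra) HT Hf ltac:(now rewrite Nat.add_0_r) 0%nat 0%nat).
    lia.
Qed.

Lemma advection_iterate_layer_bound (j : nat) : exists C, 0 < C /\
  forall nu M G f gad ua, 0 < nu <= 1 -> 0 <= M -> 0 <= G -> smooth2 f -> smooth1 gad ->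
  advection_iterate f gad ua -> bound2 j (- L1) L2 T M f -> bound1 j 0 T G gad ->
  wsq 0 L2 T (a / nu) (Nat.iter j (dt_plus c) ua) <= C * nu * (M + G).
Proof.
  set (K := (2 + 2 * c ^ 2) ^ j).
  assert (HK : 0 < K) by (apply pow_lt; nra).
  assert (H1 : 0 < 2 / a * K) by (apply Rmult_lt_0_compat; [apply Rdiv_lt_0_compat|]; lra).
  assert (H2 : 0 < 4 / a ^ 4 * K).
  { apply Rmult_lt_0_compat; [apply Rdiv_lt_0_compat|]; [lra | now apply pow_lt | lra]. }
  exists (2 / a * K + 4 / a ^ 4 * K). split; [lra|].
  intros nu M G f gad ua Hnu HM HG Hf Hgad Hua HB HBg.
  pose proof (advection_iterate_trace j G f gad ua Hgad Hua HBg) as B1.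
  pose proof (advection_iterate_source j M f Hf HB) as B2.
  fold K in B1, B2. destruct Hua as (Hu & He & Fu & Hi).
  pose proof (advection_layer_estimate nu a c L2 T (Nat.iter j (dt_plus c) ua)
    (Nat.iter j (dt_plus c) f) ltac:(lra) Ha Hc HL2 HT ltac:(sm) ltac:(sm)
    ltac:(now apply eqR_iter) ltac:(now apply flat_iter)) as H.
  apply Rle_trans with (1 := H).
  apply Rle_trans with (2 / a * nu * (K * G) + 4 / a ^ 4 * nu * (K * M)).
  - apply Rplus_le_compat.
    + replace (2 * nu / a) with (2 / a * nu) by (field; lra).
      apply Rmult_le_compat_l; [|exact B1].
      apply Rmult_le_pos; [left; apply Rdiv_lt_0_compat|]; lra.
    + replace (4 * nu ^ 2 / a ^ 4) with (4 / a ^ 4 * nu ^ 2) by (field; lra).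
      assert (0 < 4 / a ^ 4) by (apply Rdiv_lt_0_compat; [lra | now apply pow_lt]).
      assert (0 <= sqL2_2 0 L2 T (Nat.iter j (dt_plus c) f))
        by (apply sqL2_2_nonneg; auto; ct).
      apply Rmult_le_compat; auto.
      * apply Rmult_le_pos; [lra | apply pow2_ge_0].
      * apply Rmult_le_compat_l; [lra | nra].
  - replace ((2 / a * K + 4 / a ^ 4 * K) * nu * (M + G))
      with (2 / a * nu * (K * G) + 4 / a ^ 4 * nu * (K * M)
            + (2 / a * K * nu * M + 4 / a ^ 4 * K * nu * G)) by ring.
    assert (0 <= 2 / a * K * nu * M) by (apply Rmult_le_pos; [apply Rmult_le_pos|]; lra).
    assert (0 <= 4 / a ^ 4 * K * nu * G) by (apply Rmult_le_pos; [apply Rmult_le_pos|]; lra).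
    lra.
Qed.

(* The weight [exp (- a x / nu)] has mass [nu / a], which gives the factor [nu] here. *)
Lemma viscous_iter_layer_bound (j : nat) : exists C, 0 < C /\
  forall nu M f g u, 0 < nu <= 1 -> 0 <= M -> viscous nu a c (- L1) L2 T f g u ->
  bounded_data (j + 1) (2 * j + 1) (- L1) L2 T M f g u ->
  wsq 0 L2 T (a / nu) (Nat.iter j (dt_plus c) u) <= C * nu * M.
Proof.
  destruct (viscous_wsq_bound a c (- L1) L2 T Ha Hc ltac:(lra) HT) as [C [HC H]].
  set (K := (2 + 2 * c ^ 2 + 2 * a ^ 2) ^ j).
  assert (HK : 0 < K) by (apply pow_lt; nra).
  exists (C * K / a). split; [apply Rdiv_lt_0_compat; nra|].
  intros nu M f g u Hnu HM Hv Hb.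
  destruct (viscous_iter j 1 1 nu a c (- L1) L2 T M f g u ltac:(lra) HT Hnu HM Hv Hb) as [Hv' Hb'].
  fold K in Hb'.
  replace (C * K / a * nu * M) with (nu / a * (C * (K * M))) by (field; lra).
  apply (H nu (K * M) (a / nu) (nu / a) _ _ _ Hnu ltac:(nra) Hv' Hb').
  replace (nu / a) with (/ (a / nu)) by (field; lra).
  apply RInt_exp_le; [apply Rdiv_lt_0_compat|]; lra.
Qed.

(** It reaches [S j] applications of [d_t + c] at the price of [j], since the last one comes from
    the equation. Compared with the layer bound it saves two derivatives of the initial trace and
    gives up the factor [nu]. *)
Lemma viscous_iter_bound (j : nat) : exists C, 0 < C /\
  forall nu M f g u, 0 < nu <= 1 -> 0 <= M -> viscous nu a c (- L1) L2 T f g u ->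
  bounded_data (j + 1) (2 * j + 1) (- L1) L2 T M f g u ->
  sqL2_2 0 L2 T (Nat.iter (S j) (dt_plus c) u) <= C * M.
Proof.
  destruct (viscous_dt_plus_bound a c (- L1) L2 T Ha Hc ltac:(lra) HT) as [C [HC H]].
  set (K := (2 + 2 * c ^ 2 + 2 * a ^ 2) ^ j).
  assert (HK : 0 < K) by (apply pow_lt; nra).
  exists (C * K). split; [nra|].
  intros nu M f g u Hnu HM Hv Hb.
  destruct (viscous_iter j 1 1 nu a c (- L1) L2 T M f g u ltac:(lra) HT Hnu HM Hv Hb) as [Hv' Hb'].
  fold K in Hb'. pose proof (viscous_smooth _ _ _ _ _ _ _ _ _ Hv) as Hu.
  apply Rle_trans with (sqL2_2 (- L1) L2 T (Nat.iter (S j) (dt_plus c) u)).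
  - apply sqL2_2_restrict; [lra | lra | ct].
  - rewrite Rmult_assoc. apply (H nu (K * M) _ _ _ Hnu ltac:(nra) Hv' Hb').
Qed.

Lemma viscous_iter_dxx_bound (j : nat) : exists C, 0 < C /\
  forall nu M f g u, 0 < nu <= 1 -> 0 <= M -> viscous nu a c (- L1) L2 T f g u ->
  bounded_data (j + 2) (2 * j + 3) (- L1) L2 T M f g u ->
  sqL2_2 0 L2 T (dxx (Nat.iter j (dt_plus c) u)) <= C * M.
Proof.
  destruct (viscous_dxx_bound a c (- L1) L2 T Ha Hc ltac:(lra) HT) as [C [HC H]].
  set (K := (2 + 2 * c ^ 2 + 2 * a ^ 2) ^ j).
  assert (HK : 0 < K) by (apply pow_lt; nra).
  exists (C * K). split; [nra|].
  intros nu M f g u Hnu HM Hv Hb.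
  destruct (viscous_iter j 2 3 nu a c (- L1) L2 T M f g u ltac:(lra) HT Hnu HM Hv Hb) as [Hv' Hb'].
  fold K in Hb'. pose proof (viscous_smooth _ _ _ _ _ _ _ _ _ Hv) as Hu.
  apply Rle_trans with (sqL2_2 (- L1) L2 T (dxx (Nat.iter j (dt_plus c) u))).
  - apply sqL2_2_restrict; [lra | lra | ct].
  - rewrite Rmult_assoc. apply (H nu (K * M) _ _ _ Hnu ltac:(nra) Hv' Hb').
Qed.

Definition first_pass (nu : R) f g gad u ua em ed : Prop :=
  viscous nu a c (- L1) L2 T f g u /\ smooth1 gad /\ advection_iterate f gad ua /\
  error_system nu a c L1 L2 T u (fun x t => 1 * u x t + (- 1) * ua x t) em ed.

(** The initial guess is arbitrary, so nothing is lost by splitting [u - u_a] with the triangle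
    inequality. Using the equation of the error instead would bring in [u_xx] of the iterate; for
    two iterates this asks for initial order 7, whereas 5 is available in the first bound below. *)
Lemma first_pass_layer (nu : R) (j : nat) f g gad u ua em ed : 0 < nu ->
  first_pass nu f g gad u ua em ed ->
  RInt (fun t => Nat.iter j (dt_plus c) em 0 t ^ 2) 0 T
  <= nu / a ^ 3 * (2 * wsq 0 L2 T (a / nu) (Nat.iter (S (S j)) (dt_plus c) u)
                   + 2 * wsq 0 L2 T (a / nu) (Nat.iter (S (S j)) (dt_plus c) ua)).
Proof.
  intros Hnu (Hv & Hgad & (Hua & _) & HE).
  pose proof (viscous_smooth _ _ _ _ _ _ _ _ _ Hv) as Hu.
  pose proof (error_system_iter nu a c L1 L2 T j _ _ _ _ HT HE) as HEj.
  pose proof (err_ma_estimate nu a c L1 L2 T _ _ _ _ Hnu Ha Hc HL2 HT HEj) as H.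
  apply Rle_trans with (1 := H). apply Rmult_le_compat_l.
  { left. apply Rdiv_lt_0_compat; [lra | now apply pow_lt]. }
  change (dt_plus c (dt_plus c (Nat.iter j (dt_plus c) (fun x t => 1 * u x t + (- 1) * ua x t))))
    with (Nat.iter (S (S j)) (dt_plus c) (fun x t => 1 * u x t + (- 1) * ua x t)).
  rewrite iter_dt_plus_comb by auto.
  pose proof (wsq_comb 0 L2 T HL2 HT (a / nu) 1 (- 1) (Nat.iter (S (S j)) (dt_plus c) u)
    (Nat.iter (S (S j)) (dt_plus c) ua) ltac:(ct) ltac:(ct)) as Hw.
  lra.
Qed.

(** One factor [nu] comes from the modified advection problem, the other from the layer norms of
    [(d_t + c)^2 u] and [(d_t + c)^2 u_a]. *)
Lemma first_pass_bound : exists C, 0 < C /\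
  forall nu M G f g gad u ua em ed, 0 < nu <= 1 -> 0 <= M -> 0 <= G ->
  first_pass nu f g gad u ua em ed ->
  bounded_data 5 5 (- L1) L2 T M f g u -> bound1 3 0 T G gad ->
  RInt (fun t => em 0 t ^ 2) 0 T <= C * nu ^ 2 * (M + G).
Proof.
  destruct (viscous_iter_layer_bound 2) as [C1 [HC1 H1]].
  destruct (advection_iterate_layer_bound 2) as [C2 [HC2 H2]].
  assert (Ha3 : 0 < / a ^ 3) by (apply Rinv_0_lt_compat, pow_lt; lra).
  exists (/ a ^ 3 * (2 * C1 + 2 * C2)). split; [apply Rmult_lt_0_compat; lra|].
  intros nu M G f g gad u ua em ed Hnu HM HG HF Hb HBg.
  pose proof (first_pass_layer nu 0 f g gad u ua em ed ltac:(lra) HF) as H.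
  simpl Nat.iter in H. destruct HF as (Hv & Hgad & Hua & _).
  assert (Hf : smooth2 f) by apply (viscous_source _ _ _ _ _ _ _ _ _ Hv).
  specialize (H1 nu M f g u Hnu HM Hv
    ltac:(apply (bounded_data_le 5 3 5 5 (- L1) L2 T M M); auto; lra)).
  specialize (H2 nu M G f gad ua Hnu HM HG Hf Hgad Hua
    ltac:(apply (bound2_le 5 2 (- L1) L2 T M M); [lia | lra | apply Hb])
    ltac:(apply (bound1_le 3 2 0 T G G); auto; lra)).
  simpl Nat.iter in H1, H2.
  apply Rle_trans with (1 := H).
  replace (/ a ^ 3 * (2 * C1 + 2 * C2) * nu ^ 2 * (M + G))
    with (nu / a ^ 3 * (2 * (C1 * nu * (M + G)) + 2 * (C2 * nu * (M + G)))) by (field; lra).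
  apply Rmult_le_compat_l; [unfold Rdiv; nra|].
  assert (C1 * nu * M <= C1 * nu * (M + G)) by (apply Rmult_le_compat_l; nra).
  lra.
Qed.

(** Four applications of [d_t + c] to [u] are needed. The layer bound would ask for initial order
    [2 * 4 + 1 = 9], so the unweighted [viscous_iter_bound] at [j = 3], of order 7, is used. The [M]
    part therefore misses the second factor [nu], which the [G] part keeps. *)
Lemma first_pass_bound_dt : exists C, 0 < C /\
  forall nu M G f g gad u ua em ed, 0 < nu <= 1 -> 0 <= M -> 0 <= G ->
  first_pass nu f g gad u ua em ed ->
  bounded_data 8 8 (- L1) L2 T M f g u -> bound1 6 0 T G gad ->
  RInt (fun t => Nat.iter 2 (dt_plus c) em 0 t ^ 2) 0 T <= C * nu * (M + nu * G).
Proof.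
  destruct (viscous_iter_bound 3) as [C1 [HC1 H1]].
  destruct (advection_iterate_layer_bound 4) as [C2 [HC2 H2]].
  assert (Ha3 : 0 < / a ^ 3) by (apply Rinv_0_lt_compat, pow_lt; lra).
  exists (/ a ^ 3 * (2 * C1 + 2 * C2)). split; [apply Rmult_lt_0_compat; lra|].
  intros nu M G f g gad u ua em ed Hnu HM HG HF Hb HBg.
  pose proof (first_pass_layer nu 2 f g gad u ua em ed ltac:(lra) HF) as H.
  destruct HF as (Hv & Hgad & Hua & _).
  pose proof (viscous_smooth _ _ _ _ _ _ _ _ _ Hv) as Hu.
  assert (Hf : smooth2 f) by apply (viscous_source _ _ _ _ _ _ _ _ _ Hv).
  specialize (H1 nu M f g u Hnu HM Hv
    ltac:(apply (bounded_data_le 8 4 8 7 (- L1) L2 T M M); auto; lra || lia)).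
  specialize (H2 nu M G f gad ua Hnu HM HG Hf Hgad Hua
    ltac:(apply (bound2_le 8 4 (- L1) L2 T M M); [lia | lra | apply Hb])
    ltac:(apply (bound1_le 6 4 0 T G G); auto; lra || lia)).
  assert (H3 : wsq 0 L2 T (a / nu) (Nat.iter 4 (dt_plus c) u) <= C1 * M).
  { apply Rle_trans with (2 := H1). apply wsq_le_sqL2_2; auto; [|ct].
    left. apply Rdiv_lt_0_compat; lra. }
  apply Rle_trans with (1 := H).
  replace (/ a ^ 3 * (2 * C1 + 2 * C2) * nu * (M + nu * G))
    with (nu / a ^ 3 * (2 * (C1 * (M + nu * G)) + 2 * (C2 * (M + nu * G)))) by (field; lra).
  apply Rmult_le_compat_l; [unfold Rdiv; nra|].
  assert (C1 * M <= C1 * (M + nu * G)) by (apply Rmult_le_compat_l; nra).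
  assert (C2 * nu * (M + G) <= C2 * (M + nu * G))
    by (rewrite Rmult_assoc; apply Rmult_le_compat_l; nra).
  lra.
Qed.

End Constants.

Section Convergence.
Context (a c L1 L2 T : R) (Ha : 0 < a) (Hc : 0 < c) (HL1 : 0 < L1) (HL2 : 0 < L2) (HT : 0 < T).

(** No smallness can be expected, as the guess is unrelated to [u]; [u] and [u_a] are each bounded
    on their own. *)
Lemma first_advection_error : exists C, 0 < C /\
  forall nu M G f g gad u ua, 0 < nu <= 1 -> 0 <= M -> 0 <= G ->
  viscous nu a c (- L1) L2 T f g u -> advection_iterate a c L2 T f gad ua -> smooth1 gad ->
  bounded_data 2 2 (- L1) L2 T M f g u -> bound1 0 0 T G gad ->
  sqL2_2 0 L2 T (fun x t => 1 * u x t + (- 1) * ua x t) <= C * (M + G).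
Proof.
  destruct (viscous_wsq_bound a c (- L1) L2 T Ha Hc ltac:(lra) HT) as [C [HC H]].
  assert (Hac : 0 < a / c) by now apply Rdiv_lt_0_compat.
  assert (Hc2 : 0 < / c ^ 2) by (apply Rinv_0_lt_compat, pow_lt; lra).
  assert (HLC : 0 < L2 * C) by nra.
  exists (2 * (L2 * C) + 2 * (a / c) + 2 * / c ^ 2). split; [lra|].
  intros nu M G f g gad u ua Hnu HM HG Hv Hua Hgad Hb HBg.
  pose proof (viscous_smooth _ _ _ _ _ _ _ _ _ Hv) as Hu.
  assert (Hf : smooth2 f) by apply (viscous_source _ _ _ _ _ _ _ _ _ Hv).
  pose proof (advection_iterate_trace a c L2 T HT 0 G f gad ua Hgad Hua HBg) as B1.
  pose proof (advection_iterate_source c L1 L2 T HL1 HL2 HT 0 M f Hf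
    ltac:(apply (bound2_le 2 0 (- L1) L2 T M M); [lia | lra | apply Hb])) as B2.
  simpl Nat.iter in B1, B2. rewrite pow_O, Rmult_1_l in B1, B2.
  destruct Hua as (Sa & Ea & Fa & Ia).
  (* With weight exponent 0 the mass of the weight is the length [L2], so this is an unweighted
     bound on [u]. *)
  specialize (H nu M 0 L2 f g u Hnu HM Hv
    ltac:(apply (bounded_data_le 2 1 2 1 (- L1) L2 T M M); auto; lra)).
  rewrite wsq_0 in H by auto.
  assert (B0 : sqL2_2 0 L2 T u <= L2 * (C * M)).
  { apply H. apply Rle_trans with (RInt (fun _ => 1) 0 L2).
    - apply RInt_le_Cont1; [lra | ct | ct |]. intros x _.
      rewrite Ropp_0, Rmult_0_l, exp_0. lra.
    - rewrite RInt_const. change ((L2 - 0) * 1 <= L2). lra. }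
  pose proof (advection_estimate a c L2 T 0 ua f Ha Hc HL2 HT (Rle_refl 0) Sa Hf Ea (Fa 0%nat)) as B3.
  rewrite !wsq_0 in B3 by auto. replace (c + a * 0 / 2) with c in B3 by field.
  pose proof (sqL2_2_comb 0 L2 T 1 (- 1) u ua HL2 HT ltac:(ct) ltac:(ct)) as HS.
  assert (a / c * RInt (fun t => ua 0 t ^ 2) 0 T <= a / c * G)
    by (apply Rmult_le_compat_l; lra).
  assert (/ c ^ 2 * sqL2_2 0 L2 T f <= / c ^ 2 * M) by (apply Rmult_le_compat_l; lra).
  assert (0 <= L2 * C * G) by (apply Rmult_le_pos; lra).
  assert (0 <= a / c * M) by (apply Rmult_le_pos; lra).
  assert (0 <= / c ^ 2 * G) by (apply Rmult_le_pos; lra).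
  nra.
Qed.

Lemma first_diffusion_error : exists C, 0 < C /\
  forall nu M G f g gad u ua em ed, 0 < nu <= 1 -> 0 <= M -> 0 <= G ->
  first_pass a c L1 L2 T nu f g gad u ua em ed ->
  bounded_data 5 5 (- L1) L2 T M f g u -> bound1 3 0 T G gad ->
  sqL2_2 (- L1) 0 T ed <= C * nu ^ 5 * (M + G).
Proof.
  destruct (first_pass_bound a c L1 L2 T Ha Hc HL1 HL2 HT) as [C [HC H]].
  assert (H8 : 0 < 8 / a ^ 5) by (apply Rdiv_lt_0_compat; [lra | now apply pow_lt]).
  exists (8 / a ^ 5 * C). split; [now apply Rmult_lt_0_compat|].
  intros nu M G f g gad u ua em ed Hnu HM HG HF Hb HBg.
  specialize (H nu M G f g gad u ua em ed Hnu HM HG HF Hb HBg).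
  destruct HF as (_ & _ & _ & HE).
  destruct (err_ad_estimate nu a c L1 L2 T _ _ _ _ ltac:(lra) Ha Hc HL1 HT HE) as [_ H2].
  apply Rle_trans with (1 := H2).
  replace (8 / a ^ 5 * C * nu ^ 5 * (M + G))
    with (8 * nu ^ 3 / a ^ 5 * (C * nu ^ 2 * (M + G))) by (field; lra).
  apply Rmult_le_compat_l; [|exact H].
  replace (8 * nu ^ 3 / a ^ 5) with (8 / a ^ 5 * nu ^ 3) by (field; lra).
  apply Rmult_le_pos; [lra | apply pow_le; lra].
Qed.

(* The second pass starts from the interface trace of the first, so [ea2 = ed1] at 0. *)
Lemma second_advection_error : exists C, 0 < C /\
  forall nu M G f g gad u ua em ed ea2 em2 ed2, 0 < nu <= 1 -> 0 <= M -> 0 <= G ->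
  first_pass a c L1 L2 T nu f g gad u ua em ed ->
  error_system nu a c L1 L2 T u ea2 em2 ed2 ->
  (forall t, 0 <= t <= T -> ea2 0 t = ed 0 t) ->
  bounded_data 5 5 (- L1) L2 T M f g u -> bound1 3 0 T G gad ->
  sqL2_2 0 L2 T ea2 <= C * nu ^ 2 * (M + nu ^ 2 * G).
Proof.
  destruct (first_pass_bound a c L1 L2 T Ha Hc HL1 HL2 HT) as [C1 [HC1 H1]].
  destruct (viscous_iter_dxx_bound a c L1 L2 T Ha Hc HL1 HL2 HT 0) as [C2 [HC2 H2]].
  assert (Hp : 0 < a / c * (4 / a ^ 4)).
  { apply Rmult_lt_0_compat; apply Rdiv_lt_0_compat; auto; [lra | now apply pow_lt]. }
  assert (Hc2 : 0 < / c ^ 2) by (apply Rinv_0_lt_compat, pow_lt; lra).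
  exists (a / c * (4 / a ^ 4) * C1 + / c ^ 2 * C2). split; [nra|].
  intros nu M G f g gad u ua em ed ea2 em2 ed2 Hnu HM HG HF HE2 Htr Hb HBg.
  specialize (H1 nu M G f g gad u ua em ed Hnu HM HG HF Hb HBg).
  destruct HF as (Hv & _ & _ & HE).
  specialize (H2 nu M f g u Hnu HM Hv
    ltac:(apply (bounded_data_le 5 2 5 3 (- L1) L2 T M M); auto; lra || lia)).
  simpl Nat.iter in H2.
  destruct (err_ad_estimate nu a c L1 L2 T _ _ _ _ ltac:(lra) Ha Hc HL1 HT HE) as [H3 _].
  pose proof (err_a_estimate nu a c L1 L2 T _ _ _ _ Ha Hc HL2 HT HE2) as H4.
  rewrite (RInt_ext_open (fun t => ea2 0 t ^ 2) (fun t => ed 0 t ^ 2)) in H4.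
  2: lra. 2: intros t Ht; rewrite Htr by lra; reflexivity.
  apply Rle_trans with (1 := H4).
  (* The interface part is of order [nu ^ 4] in both [M] and [G]. The source [nu u_xx] of the error
     equation contributes [nu ^ 2] in [M] only, which explains the unequal powers in the
     conclusion. *)
  assert (B1 : RInt (fun t => ed 0 t ^ 2) 0 T <= 4 * nu ^ 2 / a ^ 4 * (C1 * nu ^ 2 * (M + G))).
  { apply Rle_trans with (1 := H3). apply Rmult_le_compat_l; [|exact H1].
    left. apply Rdiv_lt_0_compat; [|now apply pow_lt]. nra. }
  assert (Hac : 0 < a / c) by now apply Rdiv_lt_0_compat.
  apply Rle_trans with (a / c * (4 * nu ^ 2 / a ^ 4 * (C1 * nu ^ 2 * (M + G)))
    + nu ^ 2 / c ^ 2 * (C2 * M)).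
  - apply Rplus_le_compat; apply Rmult_le_compat_l; try lra.
    unfold Rdiv. pose proof (pow2_ge_0 nu). nra.
  - replace (a / c * (4 * nu ^ 2 / a ^ 4 * (C1 * nu ^ 2 * (M + G))) + nu ^ 2 / c ^ 2 * (C2 * M))
      with (nu ^ 2 * (a / c * (4 / a ^ 4) * C1 * (nu ^ 2 * (M + G)) + / c ^ 2 * C2 * M))
      by (field; lra).
    replace ((a / c * (4 / a ^ 4) * C1 + / c ^ 2 * C2) * nu ^ 2 * (M + nu ^ 2 * G))
      with (nu ^ 2 * ((a / c * (4 / a ^ 4) * C1 + / c ^ 2 * C2) * (M + nu ^ 2 * G))) by ring.
    apply Rmult_le_compat_l; [apply pow2_ge_0|].
    assert (Hn : 0 <= nu ^ 2 <= 1) by nra.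
    assert (a / c * (4 / a ^ 4) * C1 * (nu ^ 2 * (M + G))
      <= a / c * (4 / a ^ 4) * C1 * (M + nu ^ 2 * G)) by (apply Rmult_le_compat_l; nra).
    assert (/ c ^ 2 * C2 * M <= / c ^ 2 * C2 * (M + nu ^ 2 * G))
      by (apply Rmult_le_compat_l; nra).
    lra.
Qed.

(** Up to the factor [M + nu * G] the powers of [nu] accumulate as follows: 1 for the trace [X] of
    the twice differentiated [em], 3 for the trace [Y] of [ed], 4 for the layer norm [W] of [ea2], 5
    for the trace [V] of [em2], and 8 for [ed2]. In [W] the source term [nu ^ 4 * Z] has the same
    order as the trace term, so the loss of a factor [nu] on [M] in [X] does not worsen the
    result. *)
Lemma second_diffusion_error : exists C, 0 < C /\
  forall nu M G f g gad u ua em ed ea2 em2 ed2, 0 < nu <= 1 -> 0 <= M -> 0 <= G ->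
  first_pass a c L1 L2 T nu f g gad u ua em ed ->
  error_system nu a c L1 L2 T u ea2 em2 ed2 ->
  (forall t, 0 <= t <= T -> ea2 0 t = ed 0 t) ->
  bounded_data 8 8 (- L1) L2 T M f g u -> bound1 6 0 T G gad ->
  sqL2_2 (- L1) 0 T ed2 <= C * nu ^ 8 * (M + nu * G).
Proof.
  destruct (first_pass_bound_dt a c L1 L2 T Ha Hc HL1 HL2 HT) as [C1 [HC1 H1]].
  destruct (viscous_iter_dxx_bound a c L1 L2 T Ha Hc HL1 HL2 HT 2) as [C2 [HC2 H2]].
  assert (Hp : forall n, 0 < / a ^ n) by (intros n; apply Rinv_0_lt_compat; now apply pow_lt).
  pose proof (Rmult_lt_0_compat _ _ (Hp 13%nat) HC1) as P1.
  pose proof (Rmult_lt_0_compat _ _ (Hp 12%nat) HC2) as P2.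
  (* The products of the constants along the two branches of the chain: [8 * 2 * 4] over
     [a ^ (5 + 3 + 1 + 4)] for the trace, [8 * 4] over [a ^ (5 + 3 + 4)] for [u_xx]. *)
  exists (64 * (/ a ^ 13 * C1) + 32 * (/ a ^ 12 * C2)). split; [lra|].
  intros nu M G f g gad u ua em ed ea2 em2 ed2 Hnu HM HG HF HE2 Htr Hb HBg.
  specialize (H1 nu M G f g gad u ua em ed Hnu HM HG HF Hb HBg).
  destruct HF as (Hv & _ & _ & HE).
  specialize (H2 nu M f g u Hnu HM Hv
    ltac:(apply (bounded_data_le 8 4 8 7 (- L1) L2 T M M); auto; lra || lia)).
  pose proof (error_system_iter nu a c L1 L2 T 2 _ _ _ _ HT HE) as HEi.
  pose proof (error_system_iter nu a c L1 L2 T 2 _ _ _ _ HT HE2) as HE2i.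
  destruct (err_smooth _ _ _ _ _ _ _ _ _ _ HE) as (_ & _ & _ & Sed).
  destruct (err_smooth _ _ _ _ _ _ _ _ _ _ HE2) as (_ & Sea2 & _ & _).
  destruct (err_ad_estimate nu a c L1 L2 T _ _ _ _ ltac:(lra) Ha Hc HL1 HT HEi) as [H3 _].
  pose proof (err_a_layer_estimate nu a c L1 L2 T _ _ _ _ ltac:(lra) Ha Hc HL2 HT HE2i) as H4.
  rewrite (RInt_ext_open (fun t => Nat.iter 2 (dt_plus c) ea2 0 t ^ 2)
    (fun t => Nat.iter 2 (dt_plus c) ed 0 t ^ 2)) in H4.
  2: lra.
  2:{ intros t Ht. f_equal. simpl. revert t Ht.
      assert (K1 := trace_eq_dt_plus c 0 0 T ea2 ed HT Sea2 Sed Htr).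
      assert (K2 := trace_eq_dt_plus c 0 0 T (dt_plus c ea2) (dt_plus c ed) HT ltac:(sm) ltac:(sm) K1).
      intros t Ht. apply K2. lra. }
  pose proof (err_ma_estimate nu a c L1 L2 T _ _ _ _ ltac:(lra) Ha Hc HL2 HT HE2) as H5.
  change (dt_plus c (dt_plus c ea2)) with (Nat.iter 2 (dt_plus c) ea2) in H5.
  destruct (err_ad_estimate nu a c L1 L2 T _ _ _ _ ltac:(lra) Ha Hc HL1 HT HE2) as [_ H6].
  assert (Hq : forall k n, 0 <= k -> 0 <= k * nu ^ n) by
    (intros k n Hk; apply Rmult_le_pos; [exact Hk | apply pow_le; lra]).
  set (X := RInt (fun t => Nat.iter 2 (dt_plus c) em 0 t ^ 2) 0 T) in *.
  set (Y := RInt (fun t => Nat.iter 2 (dt_plus c) ed 0 t ^ 2) 0 T) in *.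
  set (Z := sqL2_2 0 L2 T (dxx (Nat.iter 2 (dt_plus c) u))) in *.
  set (W := wsq 0 L2 T (a / nu) (Nat.iter 2 (dt_plus c) ea2)) in *.
  set (V := RInt (fun t => em2 0 t ^ 2) 0 T) in *.
  assert (B1 : Y <= 4 * nu ^ 2 / a ^ 4 * (C1 * nu * (M + nu * G))).
  { apply Rle_trans with (1 := H3). apply Rmult_le_compat_l; [|exact H1].
    replace (4 * nu ^ 2 / a ^ 4) with (4 * / a ^ 4 * nu ^ 2) by (field; lra).
    apply Hq. pose proof (Hp 4%nat). lra. }
  assert (B2 : W <= 2 * nu / a * (4 * nu ^ 2 / a ^ 4 * (C1 * nu * (M + nu * G)))
    + 4 * nu ^ 4 / a ^ 4 * (C2 * M)).
  { apply Rle_trans with (1 := H4). apply Rplus_le_compat; apply Rmult_le_compat_l; auto.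
    - left. apply Rdiv_lt_0_compat; lra.
    - replace (4 * nu ^ 4 / a ^ 4) with (4 * / a ^ 4 * nu ^ 4) by (field; lra).
      apply Hq. pose proof (Hp 4%nat). lra. }
  assert (B3 : V <= nu / a ^ 3 * (2 * nu / a * (4 * nu ^ 2 / a ^ 4 * (C1 * nu * (M + nu * G)))
    + 4 * nu ^ 4 / a ^ 4 * (C2 * M))).
  { apply Rle_trans with (1 := H5). apply Rmult_le_compat_l; [|exact B2].
    left. apply Rdiv_lt_0_compat; [lra | now apply pow_lt]. }
  apply Rle_trans with (1 := H6).
  apply Rle_trans with (8 * nu ^ 3 / a ^ 5 * (nu / a ^ 3 *
    (2 * nu / a * (4 * nu ^ 2 / a ^ 4 * (C1 * nu * (M + nu * G))) + 4 * nu ^ 4 / a ^ 4 * (C2 * M)))).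
  - apply Rmult_le_compat_l; [|exact B3].
    replace (8 * nu ^ 3 / a ^ 5) with (8 * / a ^ 5 * nu ^ 3) by (field; lra).
    apply Hq. pose proof (Hp 5%nat). lra.
  - replace (8 * nu ^ 3 / a ^ 5 * (nu / a ^ 3 *
      (2 * nu / a * (4 * nu ^ 2 / a ^ 4 * (C1 * nu * (M + nu * G))) + 4 * nu ^ 4 / a ^ 4 * (C2 * M))))
      with (nu ^ 8 * (64 * (/ a ^ 13 * C1) * (M + nu * G) + 32 * (/ a ^ 12 * C2) * M))
      by (field; lra).
    replace ((64 * (/ a ^ 13 * C1) + 32 * (/ a ^ 12 * C2)) * nu ^ 8 * (M + nu * G))
      with (nu ^ 8 * ((64 * (/ a ^ 13 * C1) + 32 * (/ a ^ 12 * C2)) * (M + nu * G))) by ring.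
    apply Rmult_le_compat_l; [apply pow_le; lra|].
    assert (32 * (/ a ^ 12 * C2) * M <= 32 * (/ a ^ 12 * C2) * (M + nu * G))
      by (apply Rmult_le_compat_l; nra).
    lra.
Qed.

End Convergence.

Theorem theorem3p5 (a c L1 L2 T : R)
  (ha : 0 < a) (hc : 0 < c) (hL1 : 0 < L1) (hL2 : 0 < L2) (hT : 0 < T) :
  exists C nubar : R, 0 < C /\ 0 < nubar /\
  forall nu : R, 0 < nu <= nubar ->
  forall (h : R -> R) (f : R -> R -> R) (g1 g2 gad0 : R -> R),
    C0inf_open (- L1) 0 h ->
    C0inf_cyl (- L1) L2 T f ->
    C0inf_time T g1 ->
    (forall t : R, g2 t = 0) ->
    C0inf_time T gad0 ->
  forall u : R -> R -> R,
    viscous_solution nu a c L1 L2 T f h g1 g2 u ->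
  forall ua1 uma1 uad1 ua2 uma2 uad2 : R -> R -> R,
    factorization_iteration nu a c L1 L2 T f h g1 g2 gad0 ua1 uma1 uad1 ->
    factorization_iteration nu a c L1 L2 T f h g1 g2
      (fun t => uad1 0 t) ua2 uma2 uad2 ->
  let B := fun k : nat => data_bound k L1 L2 T f h g1 in
  sqL2_2 0 L2 T (fun x t => u x t - ua1 x t)
    <= C * (B 2%nat + sqL2_1 0 T gad0) /\
  sqL2_2 (- L1) 0 T (fun x t => u x t - uad1 x t)
    <= C * nu ^ 5 * (B 5%nat + sqH_1 3 0 T gad0) /\
  sqL2_2 0 L2 T (fun x t => u x t - ua2 x t)
    <= C * nu ^ 2 * (B 5%nat + nu ^ 2 * sqH_1 3 0 T gad0) /\
  sqL2_2 (- L1) 0 T (fun x t => u x t - uad2 x t)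
    <= C * nu ^ 8 * (B 8%nat + nu * sqH_1 6 0 T gad0).
Proof.
  destruct (first_advection_error a c L1 L2 T ha hc hL1 hL2 hT) as [C1 [HC1 H1]].
  destruct (first_diffusion_error a c L1 L2 T ha hc hL1 hL2 hT) as [C2 [HC2 H2]].
  destruct (second_advection_error a c L1 L2 T ha hc hL1 hL2 hT) as [C3 [HC3 H3]].
  destruct (second_diffusion_error a c L1 L2 T ha hc hL1 hL2 hT) as [C4 [HC4 H4]].
  (* The threshold is 1: smallness of [nu] serves only to absorb higher powers of [nu] into lower
     ones. *)
  exists (C1 + C2 + C3 + C4), 1. split; [lra|]. split; [lra|].
  intros nu Hnu h f g1 g2 gad0 Hh Hf Hg1 Hg2 Hgad u Hu ua1 uma1 uad1 ua2 uma2 uad2 HF1 HF2 B.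
  assert (Hfs : smooth2 f) by apply Hf. assert (Hhs : smooth1 h) by apply Hh.
  assert (Hgs : smooth1 g1) by apply Hg1. assert (Hgads : smooth1 gad0) by apply Hgad.
  assert (Huad : smooth2 uad1) by apply HF1.
  pose proof (viscous_of_solution nu a c L1 L2 T f h g1 g2 u hL1 hL2 hT Hf Hg1 Hg2 Hu) as Hv.
  destruct (error_system_of_pass nu a c L1 L2 T f h g1 g2 gad0 u ua1 uma1 uad1 ltac:(lra)
    hL1 hL2 hT Hh Hf Hg1 Hg2 Hgads Hu HF1) as [Hua1 HE1].
  destruct (error_system_of_pass nu a c L1 L2 T f h g1 g2 (fun t => uad1 0 t) u ua2 uma2 uad2
    ltac:(lra) hL1 hL2 hT Hh Hf Hg1 Hg2 ltac:(now apply smooth1_trace_t) Hu HF2) as [Hua2 HE2].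
  assert (Htr : forall t, 0 <= t <= T ->
    (fun x t => 1 * u x t + (- 1) * ua2 x t) 0 t = (fun x t => 1 * u x t + (- 1) * uad1 x t) 0 t).
  { intros t Ht. destruct Hua2 as (_ & _ & _ & E). rewrite E by auto. reflexivity. }
  assert (HP : first_pass a c L1 L2 T nu f g1 gad0 u ua1
    (fun x t => 1 * Lgen 0 a c u x t + (- 1) * uma1 x t)
    (fun x t => 1 * u x t + (- 1) * uad1 x t)) by exact (conj Hv (conj Hgads (conj Hua1 HE1))).
  assert (HB : forall k, 0 <= B k) by (intros k; now apply data_bound_nonneg).
  assert (HD : forall k, bounded_data k k (- L1) L2 T (B k) f g1 u)
    by (intros k; now apply (bounded_data_of_solution k nu a c L1 L2 T f h g1 g2 u)).
  assert (HG : forall k, 0 <= sqH_1 k 0 T gad0) by (intros k; apply sqH_1_nonneg; auto; lra).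
  assert (HGB : forall k, bound1 k 0 T (sqH_1 k 0 T gad0) gad0)
    by (intros k; apply bound1_sqH_1; auto; lra).
  specialize (H1 nu (B 2%nat) (sqH_1 0 0 T gad0) f g1 gad0 u ua1 Hnu (HB 2%nat) (HG 0%nat)
    Hv Hua1 Hgads (HD 2%nat) (HGB 0%nat)).
  change (sqH_1 0 0 T gad0) with (sqL2_1 0 T gad0) in H1.
  specialize (H2 nu (B 5%nat) _ f g1 gad0 u ua1 _ _ Hnu (HB 5%nat) (HG 3%nat) HP (HD 5%nat) (HGB 3%nat)).
  specialize (H3 nu (B 5%nat) _ f g1 gad0 u ua1 _ _ _ _ _ Hnu (HB 5%nat) (HG 3%nat) HP HE2 Htr
    (HD 5%nat) (HGB 3%nat)).
  specialize (H4 nu (B 8%nat) _ f g1 gad0 u ua1 _ _ _ _ _ Hnu (HB 8%nat) (HG 6%nat) HP HE2 Htr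
    (HD 8%nat) (HGB 6%nat)).
  assert (E : forall v : R -> R -> R,
    (fun x t => u x t - v x t) = fun x t => 1 * u x t + (- 1) * v x t).
  { intros v. apply functional_extensionality; intros x.
    apply functional_extensionality; intros t. ring. }
  assert (HG0 : 0 <= sqL2_1 0 T gad0) by exact (HG 0%nat).
  pose proof (HB 2%nat). pose proof (HB 5%nat). pose proof (HB 8%nat).
  pose proof (HG 3%nat). pose proof (HG 6%nat).
  assert (Hpow : forall n, 0 <= nu ^ n) by (intros n; apply pow_le; lra).
  rewrite !E. repeat split.
  - apply Rle_trans with (1 := H1). apply Rmult_le_compat_r; lra.
  - apply Rle_trans with (1 := H2). apply Rmult_le_compat_r; [lra|].
    apply Rmult_le_compat_r; [apply Hpow | lra].
  - apply Rle_trans with (1 := H3).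
    apply Rmult_le_compat_r; [pose proof (Hpow 2%nat); nra|].
    apply Rmult_le_compat_r; [apply Hpow | lra].
  - apply Rle_trans with (1 := H4).
    apply Rmult_le_compat_r; [nra|].
    apply Rmult_le_compat_r; [apply Hpow | lra].
Qed.
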